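(* Consider the LQG setting of the context. Using optimal input and output sequences, the static LQG gain $K_{\rm LQG}$ can be written as $$K_{\rm LQG}=\bar U_c\,H_{n,c}^\dagger ,\qquad c\ge n(l+1),$$ where $\bar U_c$ and $H_{n,c}$ are the data matrices of the context; that is, the LQG controller can be learned from an expert (optimal) input-output trajectory of length $T\ge n(l+2)-1$ (with $c=T-n+1$). Moreover: (a) for single-input systems ($m=1$), the data matrix $H_{n,c}$ is of full row rank, and the gain $K_{\rm LQG}$ is unique and can be reconstructed exactly from data; (b) for multi-input systems ($m>1$), $H_{n,c}$ loses (row) rank, and there exist multiple static LQG gains that satisfy the relation $u^*(s+n)=K_{\rm LQG}\begin{bmatrix}U_n(s)\\ Y_n(s+1)\end{bmatrix}$.
   Context: System: $x(t+1)=Ax(t)+Bu(t)+w(t)$, $y(t)=Cx(t)+v(t)$, $t\ge0$, with $x(t)\in\mathbb R^n$, $u(t)\in\mathbb R^m$, $y(t)\in\mathbb R^l$; the process and measurement noise sequences are independent at all times, with $w(t)\sim\mathcal N(0,W)$, $v(t)\sim\mathcal N(0,V)$, $W\succeq0$, $V\succ0$. $(A,B)$ and $(A,W^{1/2})$ are controllable, $(A,C)$ is observable. The LQG problem minimizes $\lim_{T\to\infty}\mathbb E[\frac1T\sum_{t=0}^{T-1}(x(t)^{\mathsf T}Qx(t)+u(t)^{\mathsf T}Ru(t))]$ with $Q\succeq0$, $R\succ0$, $(A,Q^{1/2})$ observable. LQG controller: $\hat x(t+1)=E\hat x(t)+Fu(t)+Gy(t+1)$, $u(t)=H\hat x(t)$,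 with $E=(I-L_{\rm f}C)A$, $F=(I-L_{\rm f}C)B$, $G=L_{\rm f}$, $H=K_{\rm LQR}$, where $K_{\rm LQR}\in\mathbb R^{m\times n}$ is the LQR gain for the weights $Q,R$ (with the sign convention that the optimal input is $u=K_{\rm LQR}\hat x$) and $L_{\rm f}\in\mathbb R^{n\times l}$ is the (steady-state) Kalman gain of the system. Standing assumption on the controller: for every $i\in\{1,\dots,m\}$ the pair $(E,K_{{\rm LQR},i})$ is observable, where $K_{{\rm LQR},i}$ is the $i$-th row of $K_{\rm LQR}$, and the pair $(E,L_{\rm f})$ is controllable. Data: $u^*$ are the optimal LQG inputs and $y^*$ the corresponding outputs of the system; the expert trajectory of length $T$ consists of their values from time $t$ to $t+T$. With $U_n(s)=[u^*(s)^{\mathsf T},\dots,u^*(s+n-1)^{\mathsf T}]^{\mathsf T}$ and $Y_n(s)=[y^*(s)^{\mathsf T},\dots,y^*(s+n-1)^{\mathsf T}]^{\mathsf T}$, $$H_{n,c}=\begin{bmatrix}U_n(t)&\cdots&U_n(t+c-1)\\ Y_n(t+1)&\cdots&Y_n(t+c)\end{bmatrix},\qquad \bar U_c=\begin{bmatrix}u^*(t+n)&\cdots&u^*(t+n+c-1)\end{bmatrix}.$$ (The data matrix $H_{n,c}$ is not to be confused with the controller matrix $H$.) Static LQG gain: the optimal LQG inputs satisfy $u^*(s+n)=K_{\rm LQG}\begin{bmatrix}U_n(s)\\ Y_n(s+1)\end{bmatrix}$, where $K_{\rm LQG}=H\begin{bmatrix}F_u+E^nF_x^\dagger(I-M_u)&F_y-E^nF_x^\dagger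 M_y\end{bmatrix}$. Here $F_u=[E^{n-1}F\ \cdots\ EF\ F]$, $F_y=[E^{n-1}G\ \cdots\ EG\ G]$, $F_x=\begin{bmatrix}H\\ HE\\ \vdots\\ HE^{n-1}\end{bmatrix}$; $M_u$ (resp. $M_y$) is the $n\times n$ block matrix with $(i,j)$ block $HE^{i-j-1}F$ (resp. $HE^{i-j-1}G$) for $i>j$ and $0$ otherwise. $\dagger$ is the Moore–Penrose pseudoinverse.
   Formalization: Data claims hold almost surely, initial state independent of later noise; for m>1 the learned matrix is shown to be a static LQG gain, as equality with the formula can fail; (a) assumes the controller state is not confined to a proper subspace, without which full row rank fails. *)

(* Defs.v *)
From mathcomp Require Import all_boot all_order all_algebra.
From mathcomp Require Import all_classical all_reals all_analysis.

Set Implicit Arguments.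
Unset Strict Implicit.
Unset Printing Implicit Defensive.

Import Order.TTheory GRing.Theory Num.Theory.

Local Open Scope classical_set_scope.
Local Open Scope ring_scope.

Section Matrices.
Variable R : realType.

Definition psd n (S : 'M[R]_n) : Prop :=
  S^T = S /\ forall z : 'cV[R]_n, 0 <= (z^T *m S *m z) 0 0.

Definition pd n (S : 'M[R]_n) : Prop :=
  S^T = S /\ forall z : 'cV[R]_n, z != 0 -> 0 < (z^T *m S *m z) 0 0.

(* S = M^(1/2); such an S exists and is unique when M is psd. *)
Definition is_psd_sqrt n (S M : 'M[R]_n) : Prop := psd S /\ S *m S = M.

Definition ctrb_mx n m (A : 'M[R]_n) (B : 'M[R]_(n, m)) :=
  \mxrow_(i < n) (A ^+ i *m B).

Definition controllable n m (A : 'M[R]_n) (B : 'M[R]_(n, m)) : bool :=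
  \rank (ctrb_mx A B) == n.

Definition obsv_mx n l (A : 'M[R]_n) (C : 'M[R]_(l, n)) :=
  \mxcol_(i < n) (C *m A ^+ i).

Definition observable n l (A : 'M[R]_n) (C : 'M[R]_(l, n)) : bool :=
  \rank (obsv_mx A C) == n.

(* The four Penrose equations; MathComp's pinvmx satisfies only some of them. *)
Definition penrose m n (A : 'M[R]_(m, n)) (X : 'M[R]_(n, m)) : Prop :=
  [/\ A *m X *m A = A, X *m A *m X = X,
      (A *m X)^T = A *m X & (X *m A)^T = X *m A].

Definition mp_pinv m n (A : 'M[R]_(m, n)) : 'M[R]_(n, m) :=
  xget 0 [set X | penrose A X].

Lemma gram_unit r n (M : 'M[R]_(r, n)) : row_free M -> M *m M^T \in unitmx.
Proof.
move=> Mfree; rewrite -row_free_unit -kermx_eq0; apply/rowV0P => u /sub_kermxP.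
rewrite mulmxA => uMM; suff uM : u *m M = 0.
  by apply: (row_free_inj Mfree); rewrite uM mul0mx.
have : (u *m M *m (u *m M)^T) 0 0 = 0 by rewrite trmx_mul mulmxA uMM mul0mx mxE.
rewrite mxE => /eqP; rewrite psumr_eq0; last first.
  by move=> j _; rewrite [X in _ * X]mxE -expr2 sqr_ge0.
move=> /allP uM0; apply/matrixP => i j; rewrite (ord1 i) [RHS]mxE.
have := uM0 j (mem_index_enum j).
by rewrite [X in _ * X]mxE -expr2 sqrf_eq0 => /eqP.
Qed.

Lemma penrose_exists m n (A : 'M[R]_(m, n)) : exists X, penrose A X.
Proof.
have [k [c [r [-> cfree rfree]]]] : exists k (c : 'M[R]_(m, k)) (r : 'M[R]_(k, n)),
    [/\ A = c *m r, row_free c^T & row_free r].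
  exists (\rank A), (col_base A), (row_base A); split.
  - by rewrite mulmx_base.
  - by rewrite /row_free mxrank_tr; exact: col_base_full.
  - exact: row_base_free.
have rr : r *m r^T \in unitmx by exact: gram_unit.
have cc : c^T *m c \in unitmx by have := gram_unit cfree; rewrite trmxK.
pose p := r^T *m invmx (r *m r^T); pose q := invmx (c^T *m c) *m c^T.
have rp : r *m p = 1%:M by rewrite /p mulmxA mulmxV.
have qc : q *m c = 1%:M by rewrite /q -mulmxA mulVmx.
have AX : c *m r *m (p *m q) = c *m q by rewrite -mulmxA (mulmxA r) rp mul1mx.
have XA : p *m q *m (c *m r) = p *m r by rewrite -mulmxA (mulmxA q) qc mul1mx.
exists (p *m q); split.
- by rewrite AX -mulmxA (mulmxA q) qc mul1mx.
- by rewrite XA -mulmxA (mulmxA r) rp mul1mx.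
- by rewrite AX /q !trmx_mul trmx_inv !trmx_mul !trmxK mulmxA.
- by rewrite XA /p !trmx_mul trmx_inv !trmx_mul !trmxK mulmxA.
Qed.

Lemma mp_pinvP m n (A : 'M[R]_(m, n)) : penrose A (mp_pinv A).
Proof. by have [X AX] := penrose_exists A; exact: (xgetPex 0 (ex_intro _ X AX)). Qed.

Lemma penrose_unique m n (A : 'M[R]_(m, n)) (X Y : 'M[R]_(n, m)) :
  penrose A X -> penrose A Y -> X = Y.
Proof.
move=> [X1 X2 X3 X4] [Y1 Y2 Y3 Y4].
have AXY : A *m X = A *m Y.
  by rewrite -X3 -{1}Y1 -mulmxA trmx_mul X3 Y3 mulmxA X1.
have XYA : X *m A = Y *m A.
  by rewrite -X4 -{1}Y1 -(mulmxA A) mulmxA trmx_mul X4 Y4 -mulmxA (mulmxA A) X1.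
by rewrite -X2 -mulmxA AXY mulmxA XYA.
Qed.

(* u = K x is the optimal infinite-horizon feedback: K = -(R + B'PB)^-1 B'PA
   with P the psd solution of the control Riccati equation (unique when (A, B)
   is controllable and (A, Q^(1/2)) observable). *)
Definition is_LQR_gain n m (A : 'M[R]_n) (B : 'M[R]_(n, m))
    (Q : 'M[R]_n) (Ru : 'M[R]_m) (K : 'M[R]_(m, n)) : Prop :=
  exists P : 'M[R]_n,
    [/\ psd P,
        P = A^T *m P *m A
            - A^T *m P *m B *m invmx (Ru + B^T *m P *m B) *m (B^T *m P *m A) + Q
      & K = - (invmx (Ru + B^T *m P *m B) *m (B^T *m P *m A))].

(* Steady-state gain of the filter in measurement-update form, with S the
   covariance of the one-step prediction error. *)
Definition is_Kalman_gain n l (A : 'M[R]_n) (C : 'M[R]_(l, n))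
    (W : 'M[R]_n) (V : 'M[R]_l) (L : 'M[R]_(n, l)) : Prop :=
  exists S : 'M[R]_n,
    [/\ psd S,
        S = A *m S *m A^T
            - A *m S *m C^T *m invmx (C *m S *m C^T + V) *m (C *m S *m A^T) + W
      & L = S *m C^T *m invmx (C *m S *m C^T + V)].

End Matrices.

Section Probability.
Context {d : measure_display} {Omega : measurableType d} {R : realType}.
Variable P : probability Omega R.

Definition random_vector k (X : Omega -> 'cV[R]_k) : Prop :=
  forall i, measurable_fun setT (fun om => X om i 0).

(* X ~ N(0, S): every linear functional of X is a centred scalar normal.
   normal_prob 0 0 is not the point mass at 0, hence the case distinction. *)
Definition centred_gaussian k (S : 'M[R]_k) (X : Omega -> 'cV[R]_k) : Prop :=
  random_vector X /\
  forall (a : 'rV[R]_k) (B : set R), measurable B ->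
    let s2 := (a *m S *m a^T) 0 0 in
    P [set om | B ((a *m X om) 0 0)] =
      if s2 == 0 then \d_(0 : R) B else normal_prob 0 (Num.sqrt s2) B.

Definition sigma_vec k (X : Omega -> 'cV[R]_k) : set_system Omega :=
  <<s [set D | exists i, exists2 B : set R,
         measurable B & D = [set om | B (X om i 0)]] >>.

Definition mutual_indep (I : eqType) (k : I -> nat)
    (X : forall i, Omega -> 'cV[R]_(k i)) : Prop :=
  forall (s : seq I) (D : I -> set Omega), uniq s ->
    (forall i, i \in s -> sigma_vec (X i) (D i)) ->
    P (\bigcap_(i in [set` s]) D i) = (\prod_(i <- s) P (D i))%E.

Definition noise_dim (n l : nat) (i : nat + nat) : nat :=
  match i with inl _ => n | inr _ => l end.

Definition noise n l (w : nat -> Omega -> 'cV[R]_n) (v : nat -> Omega -> 'cV[R]_l)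
    (i : nat + nat) : Omega -> 'cV[R]_(noise_dim n l i) :=
  match i with inl s => w s | inr s => v s end.

(* (x(0), xhat(0)) together with w(0), w(1), ... and v(1), v(2), ...: the
   initial estimate may depend on y(0), hence on v(0). *)
Definition init_noise_dim (n l : nat) (i : option (nat + nat)) : nat :=
  match i with None => (n + n)%N | Some j => noise_dim n l j end.

Definition init_noise n l (x0 xhat0 : Omega -> 'cV[R]_n)
    (w : nat -> Omega -> 'cV[R]_n) (v : nat -> Omega -> 'cV[R]_l)
    (i : option (nat + nat)) : Omega -> 'cV[R]_(init_noise_dim n l i) :=
  match i with
  | None => fun om => col_mx (x0 om) (xhat0 om)
  | Some j => noise w (fun s => v s.+1) j
  end.

End Probability.

Section LQG.
Variable R : realType.

Definition ctrl_E n l (A : 'M[R]_n) (C : 'M[R]_(l, n)) (L : 'M[R]_(n, l)) : 'M[R]_n :=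
  (1%:M - L *m C) *m A.

Definition ctrl_F n m l (B : 'M[R]_(n, m)) (C : 'M[R]_(l, n)) (L : 'M[R]_(n, l)) :
    'M[R]_(n, m) :=
  (1%:M - L *m C) *m B.

Definition plant n m l (A : 'M[R]_n) (B : 'M[R]_(n, m)) (C : 'M[R]_(l, n))
    (w : nat -> 'cV[R]_n) (v : nat -> 'cV[R]_l)
    (x : nat -> 'cV[R]_n) (u : nat -> 'cV[R]_m) (y : nat -> 'cV[R]_l) : Prop :=
  forall s, x s.+1 = A *m x s + B *m u s + w s /\ y s = C *m x s + v s.

Definition controller n m l (E : 'M[R]_n) (F : 'M[R]_(n, m)) (G : 'M[R]_(n, l))
    (H : 'M[R]_(m, n))
    (xhat : nat -> 'cV[R]_n) (u : nat -> 'cV[R]_m) (y : nat -> 'cV[R]_l) : Prop :=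
  forall s, xhat s.+1 = E *m xhat s + F *m u s + G *m y s.+1 /\
            u s = H *m xhat s.

Definition Fu_mx n m (E : 'M[R]_n) (F : 'M[R]_(n, m)) :=
  \mxrow_(j < n) (E ^+ (n - j.+1) *m F).

(* M_u is M_mx E F H and M_y is M_mx E G H; likewise F_y is Fu_mx E G and F_x is
   obsv_mx E H. *)
Definition M_mx n m k (E : 'M[R]_n) (F : 'M[R]_(n, k)) (H : 'M[R]_(m, n)) :=
  \mxblock_(i < n, j < n)
    (if (j < i)%N then H *m E ^+ (i - j - 1) *m F else 0 : 'M[R]_(m, k)).

Definition K_LQG n m l (E : 'M[R]_n) (F : 'M[R]_(n, m)) (G : 'M[R]_(n, l))
    (H : 'M[R]_(m, n)) : 'M[R]_(m, \sum_(i < n) m + \sum_(i < n) l) :=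
  let Fx_pinv := mp_pinv (obsv_mx E H) in
  H *m row_mx (Fu_mx E F + E ^+ n *m Fx_pinv *m (1%:M - M_mx E F H))
              (Fu_mx E G - E ^+ n *m Fx_pinv *m M_mx E G H).

(* U_n(s) is stack n u s and Y_n(s) is stack n y s. *)
Definition stack n k (z : nat -> 'cV[R]_k) (s : nat) : 'cV[R]_(\sum_(i < n) k) :=
  \mxcol_(i < n) z (s + i)%N.

Definition data_mx n m l c (u : nat -> 'cV[R]_m) (y : nat -> 'cV[R]_l) (t : nat) :
    'M[R]_(\sum_(i < n) m + \sum_(i < n) l, c) :=
  col_mx (\matrix_(i < _, j < c) stack n u (t + j) i 0)
         (\matrix_(i < _, j < c) stack n y (t + j).+1 i 0).

Definition next_inputs n m c (u : nat -> 'cV[R]_m) (t : nat) : 'M[R]_(m, c) :=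
  \matrix_(i < _, j < c) u (t + n + j)%N i 0.

Definition learned_gain n m l c (u : nat -> 'cV[R]_m) (y : nat -> 'cV[R]_l) (t : nat) :
    'M[R]_(m, \sum_(i < n) m + \sum_(i < n) l) :=
  next_inputs n c u t *m mp_pinv (data_mx n c u y t).

Definition static_gain_from n m l (t0 : nat)
    (u : nat -> 'cV[R]_m) (y : nat -> 'cV[R]_l)
    (K : 'M[R]_(m, \sum_(i < n) m + \sum_(i < n) l)) : Prop :=
  forall s, (t0 <= s)%N -> u (s + n)%N = K *m col_mx (stack n u s) (stack n y s.+1).

End LQG.

(* Main.v *)
Require Import Defs.
From mathcomp Require Import all_boot all_order all_algebra.
From mathcomp Require Import all_classical all_reals all_analysis.
From mathcomp Require Import measurable_realfun zify.

Set Implicit Arguments.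
Unset Strict Implicit.
Unset Printing Implicit Defensive.

Import Order.TTheory GRing.Theory Num.Theory.

Local Open Scope classical_set_scope.
Local Open Scope ring_scope.

(** Along the closed loop the controller state obeys xhat(s+1) = Phi xhat(s) + L y(s+1)
    with Phi = E + F K, so each data column is a fixed matrix (of full column rank)
    times zeta(s) = (xhat(s), y(s+1), ..., y(s+n)), a vector of size n + n l.  Both
    claims about the learned gain reduce to: almost surely, every row vector that
    annihilates the first n (l + 1) vectors zeta(t), zeta(t+1), ... annihilates all
    later ones.

    Write g_i for the effect on zeta(s) of its i-th most recent output.  Modulo
    g_0, ..., g_(j-1), the vector zeta(t+k) is affine in y(t+k+n-j) with coefficient
    g_j, all the rest being determined earlier; since V is positive definite, the
    fresh noise v(t+k+n-j) almost surely moves zeta(t+k) out of the span of the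
    preceding vectors unless that span already contains the range of g_j.  Counting
    dimensions for j = 2n-1, ..., 0 shows that n (l + 1) vectors suffice to span the
    ranges of all the g_i; the part that no output reaches evolves deterministically
    and is handled by Cayley-Hamilton.

    For one input, controllability of (A, B) makes the part of Phi that no output
    reaches cyclic.  Hence finitely many row vectors detect all the degenerate values
    of xhat(t), and the excitation hypothesis, which holds almost surely for each
    vector separately, holds almost surely for all of them at once. *)

(** * Fresh noise *)

Section IndependentSigmaAlgebras.
Context {d : measure_display} {Omega : measurableType d} {R : realType}.
Variable P : probability Omega R.
Variables G S : set (set Omega).
Hypotheses (GI : setI_closed G) (GT : G setT) (Gm : G `<=` measurable)
  (Sm : S `<=` measurable).
Hypothesis GS_indep : forall A B, G A -> <<s S >> B ->
  P (A `&` B) = (P A * P B)%E.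

Lemma sigma_measurable (F : set (set Omega)) :
  F `<=` measurable -> <<s F >> `<=` measurable.
Proof. by move=> Fm; apply: smallest_sub => //; exact: sigma_algebra_measurable. Qed.

(** In [A], both sides are finite measures that agree on the pi-system [G]; uniqueness of measures
    extends this to [<<s G>>]. *)
Lemma g_sigma_indep A B : <<s G >> A -> <<s S >> B ->
  P (A `&` B) = (P A * P B)%E.
Proof.
move=> GA SB; have mB := sigma_measurable Sm SB.
pose r := NngNum (fine_ge0 (measure_ge0 P B)).
have := @g_sigma_algebra_measure_unique _ R Omega G Gm (fun=> setT) (fun=> GT) _
  (mrestr P mB) (mscale r P) GI _ _ A GA.
rewrite /= /mrestr /mscale /= fineK ?fin_num_measure// [X in _ -> _ = X]muleC; apply.
- by rewrite bigcup_const.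
- by move=> X GX; rewrite GS_indep// muleC.
- by move=> _; apply: le_lt_trans (probability_le1 P _) _; rewrite ?ltry ?setTI.
Qed.

(** By independence the image of [P] under the diagonal map is the product of the two marginals, so
    Fubini reduces the claim to the sections of [D]. *)
Lemma diagonal_null (D : set (g_sigma_algebraType G * g_sigma_algebraType S)) :
  measurable D ->
  (forall om, P.-negligible [set om' | D (om, om')]) ->
  {ae P, forall om, ~ D (om, om)}.
Proof.
move=> mD D0.
have mG : measurable_fun setT (id : Omega -> g_sigma_algebraType G).
  by move=> _ Y mY; rewrite setTI; exact: sigma_measurable mY.
have mS : measurable_fun setT (id : Omega -> g_sigma_algebraType S).
  by move=> _ Y mY; rewrite setTI; exact: sigma_measurable mY.
have mGS : measurable_fun setT
    ((fun om => (om, om)) : Omega -> (g_sigma_algebraType G * g_sigma_algebraType S)%type).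
  exact: measurable_fun_pair.
pose m1 : probability (g_sigma_algebraType G) R :=
  distribution P (mfun_Sub (mem_set mG)).
pose m2 : probability (g_sigma_algebraType S) R :=
  distribution P (mfun_Sub (mem_set mS)).
pose m12 : probability (g_sigma_algebraType G * g_sigma_algebraType S)%type R :=
  distribution P (mfun_Sub (mem_set mGS)).
have eD : (m1 \x m2)%E D = m12 D.
  by apply: product_measure_unique mD => A B mA mB; exact: g_sigma_indep.
have mD' : measurable [set om : Omega | D (om, om)].
  by have := mGS measurableT D mD; rewrite setTI.
apply/negligibleP.
  exact/measurableC/measurableC.
rewrite setCK; transitivity ((m1 \x m2)%E D); first by rewrite eD.
rewrite /product_measure1 /=; apply: integral0_eq => om _ /=.
have mX : measurable (xsection D om) by exact: measurable_xsection.
have [N [mN N0 DN]] := D0 om.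
apply: (subset_measure0 _ mN _ N0); first exact: sigma_measurable mX.
move=> o; rewrite /xsection /= inE => Do; exact: DN.
Qed.

End IndependentSigmaAlgebras.

(** * Rank conditions in a form that is measurable *)

Section Ranks.
Context {R : realType}.

Lemma row_free_gram r n (X : 'M[R]_(r, n)) : row_free X = (\det (X *m X^T) != 0).
Proof.
rewrite -unitfE -unitmxE; apply/idP/idP; first exact: gram_unit.
rewrite -row_free_unit /row_free => /eqP rXX.
by rewrite eqn_leq rank_leq_row -{1}rXX mxrankM_maxl.
Qed.

(** Expresses rank by finitely many polynomial conditions on the entries: some choice of [r] rows
    has a nonzero Gram determinant. *)
Lemma leq_mxrankP m n r (M : 'M[R]_(m, n)) :
  reflect (exists f : {ffun 'I_r -> 'I_m}, \det (rowsub f M *m (rowsub f M)^T) != 0)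
    (r <= \rank M)%N.
Proof.
apply: (iffP idP) => [rM|[f]]; last first.
  by rewrite -row_free_gram => /eqP <-; rewrite rowsubE mxrankM_maxr.
pose g := maxrankfun M; pose f := [ffun i => g (widen_ord rM i)].
exists f; rewrite -row_free_gram.
have -> : rowsub f M = rowsub (widen_ord rM) (rowsub g M).
  by apply/matrixP => i j; rewrite !mxE ffunE.
have := maxrowsub_free M; rewrite -/g; set X := rowsub g M => /row_freeP[Y XY].
rewrite rowsubE; apply/row_freeP; exists (Y *m (rowsub (widen_ord rM) 1%:M)^T).
rewrite mulmxA -(mulmxA _ X) XY mulmx1; apply/matrixP => i j.
rewrite !mxE (bigD1 (widen_ord rM i))//= big1 ?addr0 => [|k ki]; last first.
  by rewrite !mxE eq_sym (negPf ki) mul0r.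
by rewrite !mxE eqxx mul1r; congr (_ %:R); congr nat_of_bool;
  rewrite eq_sym; apply/eqP/eqP=> [[/val_inj//]|->].
Qed.

(** Appending [X] shrinks the left kernel of [M] exactly when it raises the rank. This trades a
    quantifier over real vectors for a measurable rank comparison. *)
Lemma exists_annihilatorP N k q (M : 'M[R]_(N, k)) (X : 'M[R]_(N, q)) :
  (exists f : 'rV_N, f *m M = 0 /\ f *m X != 0) <->
  (\rank M < \rank (row_mx M X))%N.
Proof.
have kerS : (kermx (row_mx M X) <= kermx M)%MS.
  have := mulmx_ker (row_mx M X).
  rewrite mul_mx_row -row_mx0 => /eq_row_mx[+ _].
  by move=> e; apply/sub_kermxP.
have rker := mxrank_ker M; have rker' := mxrank_ker (row_mx M X).
have rM := rank_leq_row M; have rMX := rank_leq_row (row_mx M X).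
split=> [[f [fM fX]]|rk].
  rewrite ltnNge; apply: contra fX => le; have [_ e] := mxrank_leqif_sup kerS.
  have : (kermx M <= kermx (row_mx M X))%MS.
    by rewrite -e; have := mxrankS kerS; rewrite rker rker'; lia.
  have /sub_kermxP fM' := fM; move=> /(submx_trans fM') /sub_kermxP.
  by rewrite mul_mx_row -row_mx0 => /eq_row_mx[_ ->].
have : ~~ (kermx M <= kermx (row_mx M X))%MS.
  apply/negP => /mxrankS; rewrite rker rker'; lia.
case/row_subPn => i ni; exists (row i (kermx M)); split.
  by rewrite -row_mul mulmx_ker row0.
apply: contra ni => /eqP e; apply/sub_kermxP.
by rewrite mul_mx_row e -row_mul mulmx_ker row0 row_mx0.
Qed.

End Ranks.

Section MeasurableMatrices.
Context {d : measure_display} {T : measurableType d} {R : realType}.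

Definition measurable_mx m n (X : T -> 'M[R]_(m, n)) : Prop :=
  forall i j, measurable_fun setT (fun om => X om i j).

Lemma measurable_mx_cst m n (X : 'M[R]_(m, n)) : measurable_mx (fun=> X).
Proof. by move=> i j; exact: measurable_cst. Qed.

Lemma measurable_mxD m n (X Y : T -> 'M[R]_(m, n)) :
  measurable_mx X -> measurable_mx Y -> measurable_mx (fun om => X om + Y om).
Proof.
move=> mX mY i j; under eq_fun do rewrite mxE.
exact: measurable_funD.
Qed.

Lemma measurable_mxM m n p (X : T -> 'M[R]_(m, n)) (Y : T -> 'M[R]_(n, p)) :
  measurable_mx X -> measurable_mx Y -> measurable_mx (fun om => X om *m Y om).
Proof.
move=> mX mY i j; under eq_fun do rewrite mxE.
by apply: measurable_sum => k; exact: measurable_funM.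
Qed.

Lemma measurable_mx_sum m n I (s : seq I) (X : I -> T -> 'M[R]_(m, n)) :
  (forall i, measurable_mx (X i)) -> measurable_mx (fun om => \sum_(i <- s) X i om).
Proof.
move=> mX; elim: s => [|a s IH] i j.
  by under eq_fun do rewrite big_nil; exact: measurable_mx_cst.
by under eq_fun do rewrite big_cons; exact: measurable_mxD.
Qed.

Lemma measurable_mx_row m n p (X : T -> 'M[R]_(m, n)) (Y : T -> 'M[R]_(m, p)) :
  measurable_mx X -> measurable_mx Y -> measurable_mx (fun om => row_mx (X om) (Y om)).
Proof.
move=> mX mY i j; case: (split_ordP j) => k ->.
  by under eq_fun do rewrite row_mxEl; exact: mX.
by under eq_fun do rewrite row_mxEr; exact: mY.
Qed.

Lemma measurable_det n (X : T -> 'M[R]_n) :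
  measurable_mx X -> measurable_fun setT (fun om => \det (X om)).
Proof.
move=> mX; apply: measurable_sum => s; apply: measurable_funM => //.
by apply: measurable_prod.
Qed.

Lemma measurable_leq_mxrank m n (X : T -> 'M[R]_(m, n)) r :
  measurable_mx X -> measurable [set om | (r <= \rank (X om))%N].
Proof.
move=> mX; pose D (f : {ffun 'I_r -> 'I_m}) := 
  [set om | \det (rowsub f (X om) *m (rowsub f (X om))^T) != 0].
have -> : [set om | (r <= \rank (X om))%N] = \bigcup_(f in [set: {ffun 'I_r -> 'I_m}]) D f.
  apply/seteqP; split => [om /leq_mxrankP[f fX]|om [f _ fX]]; first by exists f.
  by apply/leq_mxrankP; exists f.
apply: fin_bigcup_measurable => // f _.
have mdet : measurable_fun setT (fun om => \det (rowsub f (X om) *m (rowsub f (X om))^T)).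
  apply: measurable_det; apply: measurable_mxM => i j; under eq_fun do rewrite ?mxE; exact: mX.
have := mdet measurableT (~` [set 0]) (measurableC (measurable_set1 0)); rewrite setTI.
by congr measurable; apply/seteqP; split => om /= /eqP.
Qed.

Lemma measurable_lt_mxrank m n p q (X : T -> 'M[R]_(m, n)) (Y : T -> 'M[R]_(p, q)) :
  measurable_mx X -> measurable_mx Y ->
  measurable [set om | (\rank (X om) < \rank (Y om))%N].
Proof.
move=> mX mY.
have -> : [set om | (\rank (X om) < \rank (Y om))%N] =
  \bigcup_r (~` [set om | (r <= \rank (X om))%N] `&` [set om | (r <= \rank (Y om))%N]).
  apply/seteqP; split => [om /= XY|om [r _ []]/=].
    by exists (\rank (Y om)) => //; split=> //=; apply/negP; rewrite -ltnNge.
  by move=> /negP; rewrite -ltnNge; exact: leq_trans.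
apply: bigcupT_measurable => r; apply: measurableI; last exact: measurable_leq_mxrank.
by apply: measurableC; exact: measurable_leq_mxrank.
Qed.

End MeasurableMatrices.

Section Fresh.
Context {d : measure_display} {Omega : measurableType d} {R : realType}.
Variable P : probability Omega R.

Lemma ae_imply (A B : Omega -> Prop) : (forall om, A om -> B om) ->
  {ae P, forall om, A om} -> {ae P, forall om, B om}.
Proof. by move=> AB; apply: negligibleS; exact: subsetC. Qed.

Lemma ae_conj (A B : Omega -> Prop) : {ae P, forall om, A om} ->
  {ae P, forall om, B om} -> {ae P, forall om, A om /\ B om}.
Proof.
move=> PA PB; apply: negligibleS (negligibleU PA PB).
by move=> om /= /not_andP[]; [left|right].
Qed.

Lemma ae_all_seq (I : eqType) (s : seq I) (Q : I -> Omega -> Prop) :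
  (forall i, i \in s -> {ae P, forall om, Q i om}) ->
  {ae P, forall om, forall i, i \in s -> Q i om}.
Proof.
elim: s => [_|i s IH sQ]; first by apply: aeW.
have Qs : {ae P, forall om, forall j, j \in s -> Q j om}.
  by apply: IH => j js; apply: sQ; rewrite inE js orbT.
apply: ae_imply (ae_conj (sQ i (mem_head _ _)) Qs) => om [Qi Qjs] j.
by rewrite inE => /predU1P[->|/Qjs].
Qed.

Lemma measurable_mx_comp d1 d2 (T1 : measurableType d1) (T2 : measurableType d2)
    m n (X : T2 -> 'M[R]_(m, n)) (f : T1 -> T2) :
  measurable_mx X -> measurable_fun setT f -> measurable_mx (fun om => X (f om)).
Proof. by move=> mX mf i j; exact: measurableT_comp (mX i j) mf. Qed.

(* Fubini freezes the past, so [f] need not be chosen measurably in [om]; the set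
   of exceptions is measurable because it is described by ranks. *)
Lemma fresh_annihilator (G S : set (set Omega)) N k l
    (M : g_sigma_algebraType G -> 'M[R]_(N, k))
    (p : g_sigma_algebraType G -> 'cV[R]_N)
    (v : g_sigma_algebraType S -> 'cV[R]_l) (X : 'M[R]_(N, l)) :
  setI_closed G -> G setT -> G `<=` measurable -> S `<=` measurable ->
  (forall A B, G A -> <<s S >> B -> P (A `&` B) = (P A * P B)%E) ->
  measurable_mx M -> measurable_mx p -> measurable_mx v ->
  (forall (b : 'rV[R]_l) c, b != 0 ->
     P.-negligible [set om : Omega | (b *m v om) 0 0 = c]) ->
  {ae P, forall om : Omega, (exists f : 'rV_N, f *m M om = 0 /\ f *m X != 0) ->
     exists f : 'rV_N, f *m M om = 0 /\ f *m (p om + X *m v om) != 0}.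
Proof.
move=> GI GT Gm Sm GS mM mp mv v0.
pose D : set (g_sigma_algebraType G * g_sigma_algebraType S) :=
  [set z | (\rank (M z.1) < \rank (row_mx (M z.1) X))%N] `&`
  ~` [set z | (\rank (M z.1) < \rank (row_mx (M z.1) (p z.1 + X *m v z.2)))%N].
have mD : measurable D.
  have mM1 := measurable_mx_comp mM (@measurable_fst _ _ _ (g_sigma_algebraType S)).
  have mp1 := measurable_mx_comp mp (@measurable_fst _ _ _ (g_sigma_algebraType S)).
  have mv2 := measurable_mx_comp mv (@measurable_snd _ _ (g_sigma_algebraType G) _).
  apply: measurableI; last apply: measurableC; apply: measurable_lt_mxrank => //.
    by apply: measurable_mx_row => //; exact: measurable_mx_cst.
  apply: measurable_mx_row => //; apply: measurable_mxD => //.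
  by apply: measurable_mxM => //; exact: measurable_mx_cst.
have D0 om : P.-negligible [set om' | D (om, om')].
  have [/exists_annihilatorP[f [fM fX]]|nX] :=
      boolP (\rank (M om) < \rank (row_mx (M om) X))%N; last first.
    apply: (negligibleS _ (negligible_set0 P)) => om' [/= h].
    by rewrite h in nX.
  (* With the past frozen, failure forces the nonzero functional [f *m X] of the noise to take one
     fixed value. *)
  apply: (negligibleS _ (v0 _ (- (f *m p om) 0 0) fX)) => om' [_ /= h].
  have [e|ne] := eqVneq (f *m (p om + X *m v om')) 0; last first.
    by case: h; apply/exists_annihilatorP; exists f.
  move: e; rewrite mulmxDr mulmxA => /matrixP/(_ 0 0); rewrite !mxE => /eqP.
  by rewrite addrC addr_eq0 => /eqP.
have := diagonal_null GI GT Gm Sm GS mD D0.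
apply: ae_imply => om nD /exists_annihilatorP h.
by apply/exists_annihilatorP; apply/negPn/negP => h'; apply: nD; split => //=; apply/negP.
Qed.

(** [b *m v] is normal with positive variance, so its law is dominated by Lebesgue measure, which
    gives points no mass. *)
Lemma pd_noise_no_mass l (V : 'M[R]_l) (v : Omega -> 'cV[R]_l) :
  pd V -> centred_gaussian P V v ->
  forall (b : 'rV[R]_l) c, b != 0 -> P.-negligible [set om : Omega | (b *m v om) 0 0 = c].
Proof.
move=> [_ V0] [mv Pv] b c b0.
have mbv : measurable_fun setT (fun om => (b *m v om) 0 0).
  under eq_fun do rewrite mxE.
  by apply: measurable_sum => k; apply: measurable_funM => //; exact: mv.
have m1 : measurable [set c] := measurable_set1 c.
have mbc : measurable [set om : Omega | (b *m v om) 0 0 = c].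
  by have := mbv measurableT [set c] m1; rewrite setTI.
apply/negligibleP => //.
have := Pv b [set c] m1; rewrite /= => ->.
have := V0 b^T; rewrite trmxK trmx_eq0 => /(_ b0) s2.
rewrite gt_eqF//.
have /null_content_dominatesP := @normal_prob_dominates R 0 (Num.sqrt ((b *m V *m b^T) 0 0)).
by apply => //; exact: lebesgue_measure_set1.
Qed.

End Fresh.

(** * Independence of one random vector from all the others *)

Section Grouping.
Context {d : measure_display} {Omega : measurableType d} {R : realType}.
Variable P : probability Omega R.
Variables (I : eqType) (k : I -> nat) (X : forall i, Omega -> 'cV[R]_(k i)).
Hypothesis Xm : forall i, random_vector (X i).
Hypothesis Xindep : mutual_indep P X.

Definition coord_events (i : I) : set (set Omega) :=
  [set D | exists j, exists2 B : set R,
     measurable B & D = [set om | B (X i om j 0)]].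

(** Finite intersections, so that these events form a pi-system to which mutual independence applies
    directly. *)
Definition other_events (i0 : I) : set (set Omega) :=
  [set A | exists s (D : I -> set Omega),
     [/\ uniq s, i0 \notin s, (forall i, i \in s -> sigma_vec (X i) (D i))
       & A = \bigcap_(i in [set` s]) D i]].

Lemma coord_events_measurable i : coord_events i `<=` measurable.
Proof.
move=> _ [j [B mB ->]]; have := @Xm i j measurableT _ mB.
by rewrite setTI.
Qed.

Lemma other_events_setI i0 : setI_closed (other_events i0).
Proof.
move=> _ _ [s1 [D1 [u1 n1 m1 ->]]] [s2 [D2 [u2 n2 m2 ->]]].
pose D i := (if i \in s1 then D1 i else setT) `&` (if i \in s2 then D2 i else setT).
exists (undup (s1 ++ s2)), D; split.
- exact: undup_uniq.
- by rewrite mem_undup mem_cat negb_or n1.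
- have sT i : sigma_vec (X i) setT
    by exact: (@measurableT _ (g_sigma_algebraType (coord_events i))).
  move=> i _; rewrite /D /sigma_vec.
  apply: (@measurableI _ (g_sigma_algebraType (coord_events i))).
    by case: ifPn => [/m1//|_]; exact: sT.
  by case: ifPn => [/m2//|_]; exact: sT.
- rewrite /D; apply/seteqP; split => [om [h1 h2] i /= _|om h].
    by split; case: ifPn => // ?; [apply: h1|apply: h2].
  split=> i /= si; have := h i; rewrite /= mem_undup mem_cat si ?orbT => /(_ isT) [];
  by [].
Qed.

Lemma other_events_setT i0 : other_events i0 setT.
Proof. by exists [::], (fun=> setT); split => //; rewrite set_nil bigcap_set0. Qed.

Lemma other_events_measurable i0 : other_events i0 `<=` measurable.
Proof.
move=> _ [s [D [us _ sD ->]]]; apply: fin_bigcap_measurable.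
  exact: finite_seq.
by move=> i /= /sD; apply: sigma_measurable; exact: coord_events_measurable.
Qed.

Lemma other_events_indep i0 A B : other_events i0 A -> <<s coord_events i0 >> B ->
  P (A `&` B) = (P A * P B)%E.
Proof.
move=> [s [D [us ns sD ->]]] mB.
pose D' i := if i == i0 then B else D i.
have D'E i : i \in s -> D' i = D i.
  by move=> si; rewrite /D'; case: eqP => // ii; rewrite -ii si in ns.
have -> : \bigcap_(i in [set` s]) D i `&` B = \bigcap_(i in [set` i0 :: s]) D' i.
  apply/seteqP; split => [om [h hB] i /=|om h].
    rewrite inE => /predU1P[->|si]; first by rewrite /D' eqxx.
    by rewrite D'E//; exact: h.
  split=> [i /= si|].
    by rewrite -D'E//; apply: h; rewrite /= inE si orbT.
  by have := h i0; rewrite /D' eqxx; apply; rewrite /= inE eqxx.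
rewrite !Xindep//.
- rewrite big_cons muleC; congr (_ * P _)%E; last by rewrite /D' eqxx.
  by apply: eq_big_seq => i si; rewrite D'E.
- by rewrite /= ns.
- move=> i; rewrite inE => /predU1P[->|si]; first by rewrite /D' eqxx.
  by rewrite D'E//; exact: sD.
Qed.

Lemma measurable_mx_self i0 :
  measurable_mx (X i0 : g_sigma_algebraType (coord_events i0) -> 'cV[R]_(k i0)).
Proof.
move=> i j _ B mB; rewrite setTI (ord1 j); apply: sub_sigma_algebra.
by exists i, B.
Qed.

Lemma measurable_mx_other i0 i : i != i0 ->
  measurable_mx (X i : g_sigma_algebraType (other_events i0) -> 'cV[R]_(k i)).
Proof.
move=> ii a j _ B mB; rewrite setTI (ord1 j); apply: sub_sigma_algebra.
exists [:: i], (fun i' => [set om | if i' == i then B (X i om a 0) else True]); split => //.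
- by rewrite inE eq_sym.
- move=> _ /[!inE] /eqP ->; rewrite eqxx; apply: sub_sigma_algebra.
  by exists a, B.
- apply/seteqP; split => [om h i' /= _|om h]; first by case: ifP.
  by have := h i; rewrite /= inE eqxx; exact.
Qed.

End Grouping.

(** * Excitation of the data vectors *)

Section Krylov.
Context {R : realType}.

Lemma exp_mx_span n (Phi : 'M[R]_n) :
  exists c : nat -> R, Phi ^+ n = \sum_(i < n) c i *: Phi ^+ i.
Proof.
case: n Phi => [|n] Phi.
  by exists (fun=> 0); rewrite (flatmx0 (Phi ^+ 0)) (flatmx0 (\sum_(i < 0) _)).
exists (fun i => - (char_poly Phi)`_i).
have hX i : horner_mx Phi ((char_poly Phi)`_i *: 'X^i) = (char_poly Phi)`_i *: Phi ^+ i.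
  by rewrite horner_mxZ rmorphXn /= horner_mx_X.
have := Cayley_Hamilton Phi; rewrite -[in X in X -> _](coefK (char_poly Phi)).
rewrite size_char_poly poly_def raddf_sum big_ord_recr /=.
have -> : (char_poly Phi)`_n.+1 = 1.
  by have /monicP := char_poly_monic Phi; rewrite /lead_coef size_char_poly.
rewrite scale1r rmorphXn /= horner_mx_X => /eqP; rewrite addrC addr_eq0 => /eqP ->.
by rewrite -sumrN; apply: eq_bigr => i _; rewrite hX scaleNr.
Qed.


Lemma krylov_annihilator n p (Phi : 'M[R]_n) (a : 'rV[R]_n) (X : 'M[R]_(n, p)) :
  (forall i, (i < n)%N -> a *m Phi ^+ i *m X = 0) ->
  forall i, a *m Phi ^+ i *m X = 0.
Proof.
move=> aX; have [c Phin] := exp_mx_span Phi.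
elim/ltn_ind => i IH; have [/aX//|ni] := ltnP i n.
rewrite -(subnKC ni) exprD Phin mulr_suml mulmx_sumr mulmx_suml big1// => r _.
rewrite -mulmxE -scalemxAl -scalemxAr -scalemxAl mulmxE -exprD IH ?scaler0//.
by have := ltn_ord r; lia.
Qed.

(** The matrix of pairings [f i *m x j] is upper triangular with nonzero diagonal, hence of rank
    [q], yet it factors through dimension [N]. *)
Lemma triangular_pairing N q (f : nat -> 'rV[R]_N) (x : nat -> 'cV[R]_N) :
  (forall i j, (j < i < q)%N -> f i *m x j = 0) ->
  (forall i, (i < q)%N -> f i *m x i != 0) -> (q <= N)%N.
Proof.
move=> fx0 fxn.
pose F := \matrix_(i < q) f i; pose X := \matrix_(a < N, j < q) x j a 0.
have FX i j : (F *m X) i j = (f i *m x j) 0 0.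
  by rewrite !mxE; apply: eq_bigr => a _; rewrite !mxE.
have trig : is_trig_mx (F *m X)^T.
  by apply/is_trig_mxP => i j ij; rewrite mxE FX fx0 ?mxE// ij ltn_ord.
have : \det (F *m X)^T != 0.
  rewrite det_trig//; apply/prodf_neq0 => i _; rewrite mxE FX.
  apply: contra (fxn i (ltn_ord i)) => /eqP e; apply/eqP/matrixP => a b.
  by rewrite !ord1 e mxE.
rewrite det_tr -unitfE -unitmxE -row_free_unit /row_free => /eqP rFX.
by have := mxrankM_maxl F X; rewrite rFX => /leq_trans; apply; exact: rank_leq_col.
Qed.

End Krylov.

Section DataVectors.
Context {R : realType}.
Variables (n l : nat) (Phi : 'M[R]_n) (L : 'M[R]_(n, l)).
Variables (xh : nat -> 'cV[R]_n) (y : nat -> 'cV[R]_l).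
Hypothesis xh_rec : forall s, xh s.+1 = Phi *m xh s + L *m y s.+1.

Definition data_vec s : 'cV[R]_(n + \sum_(i < n) l) := col_mx (xh s) (stack n y s.+1).

(* Impulse response: [resp i] is the effect on [data_vec s] of [y (s + n - i)],
   the [i]-th most recent output that it involves. *)
Definition resp (i : nat) : 'M[R]_(n + \sum_(i < n) l, l) :=
  col_mx (if (n <= i)%N then Phi ^+ (i - n) *m L else 0)
         (\mxcol_(r < n) (if (i + r).+1 == n then 1%:M else 0 : 'M[R]_l)).

Lemma xh_expand t k :
  xh (t + k)%N = Phi ^+ k *m xh t + \sum_(i < k) Phi ^+ i *m L *m y (t + k - i)%N.
Proof.
elim: k => [|k IH]; first by rewrite big_ord0 addr0 addn0 expr0 mul1mx.
rewrite addnS xh_rec IH mulmxDr mulmxA mulmx_sumr big_ord_recl expr0 mul1mx subn0.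
rewrite -addrA; congr (_ + _); first by rewrite exprS.
rewrite addrC; congr (_ + _); apply: eq_bigr => i _.
by rewrite lift0 subSS exprS -!mulmxA.
Qed.

Lemma data_vec_expand t k : data_vec (t + k) =
  col_mx (Phi ^+ k *m xh t) 0 + \sum_(i < k + n) resp i *m y (t + k + n - i)%N.
Proof.
rewrite /data_vec -[RHS]vsubmxK; congr col_mx.
  rewrite raddfD raddf_sum /= col_mxKu xh_expand; congr (_ + _).
  under [RHS]eq_bigr => i _ do rewrite /resp mul_col_mx col_mxKu.
  rewrite [RHS](eq_bigr (fun i : 'I_(k + n) => if (n <= i)%N then
    Phi ^+ (i - n) *m L *m y (t + k + n - i)%N else 0)); last first.
    by move=> i _; case: ifP => // _; rewrite mul0mx.
  rewrite -(big_mkord xpredT (fun i => Phi ^+ i *m L *m y (t + k - i)%N)).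
  rewrite -(big_mkord xpredT (fun i => if (n <= i)%N then
    Phi ^+ (i - n) *m L *m y (t + k + n - i)%N else 0)).
  rewrite (big_cat_nat (leq0n n) (leq_addl k n)) /=.
  rewrite [X in _ = X + _]big_nat_cond [X in _ = X + _]big1 ?add0r; last first.
    by move=> i /andP[/andP[_ ni] _]; rewrite leqNgt ni.
  rewrite -[X in \sum_(X <= _ < k + n) _]add0n big_addn addnK; apply: eq_bigr => i _.
  by rewrite leq_addl addnK; congr (_ *m y _); lia.
rewrite raddfD raddf_sum /= col_mxKd add0r.
under [RHS]eq_bigr => i _ do rewrite /resp mul_col_mx col_mxKd.
apply/mxcolP => r; rewrite submxcol_sum /stack mxcolK.
have E i (v : 'cV_l) : submxcol ((\mxcol_(r0 < n)
    (if (i + r0).+1 == n then 1%:M else 0 : 'M[R]_l)) *m v) r =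
    if (i + r).+1 == n then v else 0.
  by rewrite mxcol_mul mxcolK; case: ifP; rewrite ?mul1mx ?mul0mx.
rewrite (eq_bigr _ (fun (i : 'I_(k + n)) _ => E i _)).
have lt : (n - r.+1 < k + n)%N by have := ltn_ord r; lia.
rewrite (bigD1 (Ordinal lt))//= [X in _ + X]big1 ?addr0.
  by rewrite ifT; [congr y|]; have := ltn_ord r; lia.
move=> i ne; rewrite ifF//.
by apply/negP => /eqP e; move/eqP: ne; apply; apply/val_inj => /=; lia.
Qed.

(** Dual description of the span of [resp 0], ..., [resp (j - 1)] and the first [k] data vectors. *)
Definition annihilates t j k (f : 'rV[R]_(n + \sum_(i < n) l)) : Prop :=
  (forall i, (i < j)%N -> f *m resp i = 0) /\
  (forall i, (i < k)%N -> f *m data_vec (t + i) = 0).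

(** In dual form: unless that span contains the range of [resp j], [data_vec (t + k)] falls outside
    it. The bound [j < k + n] places the output concerned, [y (t + k + n - j)], after time [t]. *)
Definition exciting t : Prop := forall j k, (j < k + n)%N ->
  (exists2 f, annihilates t j k f & f *m resp j != 0) ->
  exists2 f, annihilates t j k f & f *m data_vec (t + k) != 0.

(** For [i < n], [resp i] is the identity block at output position [n - 1 - i] and zero
    elsewhere. *)
Lemma resp_ann (f : 'rV[R]_(n + \sum_(i < n) l)) :
  (forall i, (i < n)%N -> f *m resp i = 0) -> rsubmx f = 0.
Proof.
move=> f0; rewrite -[rsubmx f]submxrowK -[RHS]submxrowK; apply: eq_mxrow => r.
rewrite submxrow0.
have := f0 (n - r.+1)%N; rewrite /resp ifF; last by have := ltn_ord r; lia.
rewrite -[f]hsubmxK mul_row_col mulmx0 add0r row_mxKr -[X in X *m _ = 0]submxrowK.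
rewrite mul_mxrow_mxcol (bigD1 r)//= ifT; last by have := ltn_ord r; lia.
rewrite mulmx1 [X in _ + X]big1 ?addr0 => [|i ne]; first by apply; have := ltn_ord r; lia.
rewrite ifF ?mulmx0//; apply/negP => /eqP e; move/eqP: ne; apply; apply: val_inj => /=.
by have := ltn_ord r; have := ltn_ord i; lia.
Qed.

(* Downward induction on [j]: as long as the outputs delayed by [j] are not yet
   matched, each fresh output adds a dimension to the span of the data vectors. *)
Lemma exciting_resp t f : (0 < l)%N -> exciting t ->
  annihilates t 0 (n * (l + 1)) f -> forall i, (i < n + n)%N -> f *m resp i = 0.
Proof.
move=> l0 exc; set K := (n * (l + 1))%N.
have KE : K = (n + \sum_(i < n) l)%N by rewrite sum_nat_const card_ord /K; lia.
have K2 : (n + n <= K)%N by rewrite /K; nia.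
suff H j : (j <= n + n)%N -> forall f, annihilates t (n + n - j) K f ->
    forall i, (i < n + n)%N -> f *m resp i = 0.
  by move=> fK; apply: (H (n + n)%N) => //; rewrite subnn.
elim: j => [|j IH] jn {}f fK; first by case: fK => + _; rewrite subn0.
set J := (n + n - j.+1)%N in fK *.
have JS : (n + n - j = J.+1)%N by rewrite /J; lia.
(* One horizon [k] at which all annihilators of level [J] kill [resp J] is enough: an annihilator
   over [K] vectors is one over the first [k]. *)
suff [k kK fk] : exists2 k, (k <= K)%N & forall f, annihilates t J k f -> f *m resp J = 0.
  apply: (IH (ltnW jn)); rewrite JS; case: fK => f1 f2; split => // i.
  rewrite ltnS leq_eqVlt => /predU1P[->|]; last exact: f1.
  by apply: fk; split => // i' i'k; apply: f2; exact: leq_trans kK.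
(* Otherwise each [k] with [J < k + n] yields a functional that kills the earlier vectors but not
   the one at [t + k]: a triangular family. *)
apply: contrapT => /forall2NP nk.
have nk' k : exists g, (J.+1 - n <= k <= K)%N -> annihilates t J k g /\ g *m data_vec (t + k) != 0.
  have [/andP[k1 k2]|] := boolP (J.+1 - n <= k <= K)%N; last by exists 0.
  have [//|/existsNP[g /not_implyP[gk gJ]]] := nk k.
  have [||h hk h0] := exc J k; first by lia.
    by exists g => //; apply/eqP.
  by exists h.
have [g gP] := choice nk'.
pose k0 := (J.+1 - n)%N; have k0K : (k0 <= K)%N by rewrite /k0 /J; lia.
have [Jn|nJ] := ltnP J n.
  (* For [J < n] this gives [K + 1] independent vectors in dimension [K]. *)
  have k00 : k0 = 0%N by rewrite /k0; lia.
  suff: (K.+1 <= n + \sum_(i < n) l)%N by rewrite -KE ltnn.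
  apply: (triangular_pairing (f := g) (x := fun k => data_vec (t + k))).
    by move=> i i' /andP[ii iK]; have [|[_ g2] _] := gP i; [lia|apply: g2].
  by move=> i iK; have [|] := gP i; first by lia.
(* For [n <= J] the functionals see only the controller state, of dimension [n]; but [k0 <= n] and
   [2 * n <= K] leave more than [n] independent states. *)
suff: (K - k0 < n)%N by rewrite /k0 /J; lia.
have gl k : (k0 <= k <= K)%N -> g k *m data_vec (t + k) = 0 -> False.
  by move=> kk e; have [|_] := gP k; [exact: kk|rewrite e eqxx].
have gx k s : (k0 <= k <= K)%N -> g k *m data_vec s = lsubmx (g k) *m xh s.
  move=> kk; have [|[g1 _] _] := gP k; first exact: kk.
  have r0 : rsubmx (g k) = 0 by apply: resp_ann => i ni; apply: g1; lia.
  by rewrite -[g k in LHS]hsubmxK r0 mul_row_col mul0mx addr0.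
apply: (triangular_pairing (f := fun k => lsubmx (g (k0 + k)%N))
  (x := fun k => xh (t + (k0 + k))%N)) => [i j' /andP[ij iK]|i iK]; rewrite -gx; try lia.
  by have [|[_ g2] _] := gP (k0 + i)%N; [lia|apply: g2; lia].
by have [|] := gP (k0 + i)%N; first by lia.
Qed.

(** On the state part, [resp (n + i)] is [Phi ^+ i *m L]. Once these are killed, the first [n] data
    vectors involve only the free motion of [xh t]; Cayley-Hamilton gives the remaining powers. *)
Lemma exciting_annihilator t f : (0 < l)%N -> exciting t ->
  annihilates t 0 (n * (l + 1)) f ->
  [/\ rsubmx f = 0, forall i, lsubmx f *m Phi ^+ i *m L = 0 &
      forall i, lsubmx f *m Phi ^+ i *m xh t = 0].
Proof.
move=> l0 exc fK; have f0 := exciting_resp l0 exc fK.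
have r0 : rsubmx f = 0 by apply: resp_ann => i ni; apply: f0; lia.
have fL i : lsubmx f *m Phi ^+ i *m L = 0.
  apply: krylov_annihilator => {}i ni.
  have := f0 (n + i)%N; rewrite ltn_add2l => /(_ ni).
  by rewrite /resp -[f in f *m _]hsubmxK r0 mul_row_col mul0mx addr0 leq_addr addKn mulmxA.
split => //; apply: krylov_annihilator => i ni.
have [_ /(_ i)] := fK; have iK : (i < n * (l + 1))%N by nia.
move=> /(_ iK); rewrite /data_vec -[f in f *m _]hsubmxK r0 mul_row_col mul0mx addr0.
rewrite xh_expand mulmxDr mulmxA mulmx_sumr [X in _ + X]big1 ?addr0// => j _.
by rewrite !mulmxA fL mul0mx.
Qed.

Lemma exciting_span t f : (0 < l)%N -> exciting t ->
  annihilates t 0 (n * (l + 1)) f -> forall k, f *m data_vec (t + k) = 0.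
Proof.
move=> l0 exc /(exciting_annihilator l0 exc)[r0 fL fx] k.
rewrite /data_vec -[f in f *m _]hsubmxK r0 mul_row_col mul0mx addr0 xh_expand.
by rewrite mulmxDr mulmxA fx add0r mulmx_sumr; apply: big1 => j _; rewrite !mulmxA fL mul0mx.
Qed.

End DataVectors.

Section Excitation.
Context {d : measure_display} {Omega : measurableType d} {R : realType}.
Variable P : probability Omega R.
Variables (n m l : nat) (A : 'M[R]_n) (B : 'M[R]_(n, m)) (C : 'M[R]_(l, n)).
Variables (W : 'M[R]_n) (V : 'M[R]_l).
Variables (E : 'M[R]_n) (F : 'M[R]_(n, m)) (K : 'M[R]_(m, n)) (L : 'M[R]_(n, l)).
Variables (w : nat -> Omega -> 'cV[R]_n) (v : nat -> Omega -> 'cV[R]_l)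
  (x xhat : nat -> Omega -> 'cV[R]_n)
  (u : nat -> Omega -> 'cV[R]_m) (y : nat -> Omega -> 'cV[R]_l).
Hypotheses (V_pd : pd V)
  (w_normal : forall s, centred_gaussian P W (w s))
  (v_normal : forall s, centred_gaussian P V (v s))
  (x0_meas : random_vector (x 0%N)) (xhat0_meas : random_vector (xhat 0%N))
  (init_indep : mutual_indep P (init_noise (x 0%N) (xhat 0%N) w v))
  (plant_eq : forall om, plant A B C (w^~ om) (v^~ om) (x^~ om) (u^~ om) (y^~ om))
  (controller_eq : forall om,
     controller E F L K (xhat^~ om) (u^~ om) (y^~ om)).

Let noises := init_noise (x 0%N) (xhat 0%N) w v.

Lemma controller_closed_loop om s :
  xhat s.+1 om = (E + F *m K) *m xhat s om + L *m y s.+1 om.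
Proof.
have [-> ->] := controller_eq om s.
by rewrite mulmxDl mulmxA.
Qed.

Lemma init_noise_measurable i : random_vector (noises i).
Proof.
case: i => [[s|s]|]; [by case: (w_normal s)|by case: (v_normal s.+1)|].
move=> i; case: (split_ordP i) => j -> /=.
  by under eq_fun do rewrite col_mxEu; exact: x0_meas.
by under eq_fun do rewrite col_mxEd; exact: xhat0_meas.
Qed.

Lemma next_state_measurable s1 s :
  let T := g_sigma_algebraType (other_events noises (Some (inr s1))) in
  measurable_mx (x s : T -> _) -> measurable_mx (xhat s : T -> _) ->
  measurable_mx (x s.+1 : T -> _).
Proof.
move=> T mx mxh.
have mw : measurable_mx (w s : T -> _).
  exact: (@measurable_mx_other _ _ _ _ _ noises (Some (inr s1)) (Some (inl s)) isT).
have cM p q (D : 'M[R]_(p, q)) r (Y : T -> 'M[R]_(q, r)) : measurable_mx Y ->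
    measurable_mx (fun om => D *m Y om).
  by move=> mY; apply: measurable_mxM => //; exact: measurable_mx_cst.
rewrite (_ : x s.+1 = fun om => A *m x s om + B *m (K *m xhat s om) + w s om).
  by apply: measurable_mxD => //; apply: measurable_mxD; do ?apply: (cM).
apply/funext => om; have [-> _] := plant_eq om s.
by have [_ ->] := controller_eq om s.
Qed.

(** In [init_noise] the index [Some (inr s1)] denotes [v s1.+1]. States up to time [s1] depend only
    on the initial pair, on [w] and on [v 1], ..., [v s1]. *)
Lemma past_measurable s1 s : (s <= s1)%N ->
  let T := g_sigma_algebraType (other_events noises (Some (inr s1))) in
  measurable_mx (x s : T -> _) /\ measurable_mx (xhat s : T -> _).
Proof.
move=> + T.
have mO i : i != Some (inr s1) -> measurable_mx (noises i : T -> _).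
  exact: measurable_mx_other.
elim: s => [_|s IH ss].
  have m0 := mO None isT; split => i j.
    have := m0 (lshift _ i) j; apply: eq_measurable_fun => om _.
    by rewrite /noises /= col_mxEu.
  have := m0 (rshift _ i) j; apply: eq_measurable_fun => om _.
  by rewrite /noises /= col_mxEd.
have [mx mxh] := IH (ltnW ss).
have ne : Some (inr s) != Some (inr s1) :> option (nat + nat).
  by apply/eqP => -[e]; move: ss; rewrite e ltnn.
have mv : measurable_mx (v s.+1 : T -> _) := mO (Some (inr s)) ne.
have cM p q (D : 'M[R]_(p, q)) r (Y : T -> 'M[R]_(q, r)) : measurable_mx Y ->
    measurable_mx (fun om => D *m Y om).
  by move=> mY; apply: measurable_mxM => //; exact: measurable_mx_cst.
have mx1 := next_state_measurable mx mxh.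
split => //.
rewrite (_ : xhat s.+1 = fun om => (E + F *m K) *m xhat s om +
    L *m (C *m x s.+1 om + v s.+1 om)).
  by apply: measurable_mxD; apply: (cM) => //; apply: measurable_mxD => //; exact: (cM).
apply/funext => om; rewrite controller_closed_loop.
by have [_ ->] := plant_eq om s.+1.
Qed.

Lemma past_output_measurable s1 s : (0 < s <= s1)%N ->
  measurable_mx (y s : g_sigma_algebraType (other_events noises (Some (inr s1))) -> _).
Proof.
case: s => // s /= ss.
rewrite (_ : y s.+1 = fun om => C *m x s.+1 om + v s.+1 om); last first.
  by apply/funext => om; have [_ ->] := plant_eq om s.+1.
apply: measurable_mxD.
  apply: measurable_mxM; first exact: measurable_mx_cst.
  by have [] := past_measurable ss.
have ne : Some (inr s) != Some (inr s1) :> option (nat + nat).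
  by apply/eqP => -[e]; move: ss; rewrite e ltnn.
exact: (@measurable_mx_other _ _ _ _ _ noises _ (Some (inr s)) ne).
Qed.

(** [x s1.+1] is formed before [y s1.+1] is measured, hence does not involve [v s1.+1]. *)
Lemma fresh_state_measurable s1 :
  measurable_mx (x s1.+1 : g_sigma_algebraType (other_events noises (Some (inr s1))) -> _).
Proof.
have [mx mxh] := past_measurable (leqnn s1).
exact: next_state_measurable mx mxh.
Qed.

Local Notation g := (resp (E + F *m K) L).
Local Notation zeta om := (data_vec (xhat^~ om) (y^~ om)).

Variable t : nat.

(** The data vector without the contributions of its [j] most recent outputs. Functionals that kill
    [g 0], ..., [g (j - 1)] do not see the difference, and only earlier outputs remain. *)
Let trunc j k om : 'cV[R]_(n + \sum_(i < n) l) := 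
  col_mx ((E + F *m K) ^+ k *m xhat t om) 0 +
  \sum_(b < k + n) (if (j <= b)%N then g b *m y (t + k + n - b)%N om else 0).

Let truncE j k om (f : 'rV[R]_(n + \sum_(i < n) l)) : (forall i, (i < j)%N -> f *m g i = 0) ->
  f *m zeta om (t + k)%N = f *m trunc j k om.
Proof.
move=> f0; rewrite (data_vec_expand (controller_closed_loop om)) !mulmxDr; congr (_ + _).
rewrite !mulmx_sumr; apply: eq_bigr => b _; case: leqP => // bj.
by rewrite mulmx0 mulmxA f0// mul0mx.
Qed.

Lemma ae_exciting_step j k : (j < k + n)%N ->
  {ae P, forall om,
    (exists2 f, annihilates (E + F *m K) L (xhat^~ om) (y^~ om) t j k f & f *m g j != 0) ->
    exists2 f, annihilates (E + F *m K) L (xhat^~ om) (y^~ om) t j k f &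
      f *m zeta om (t + k)%N != 0}.
Proof.
(* [s1.+1] is the time of the output that [g j] multiplies, so the fresh noise is [v s1.+1]. *)
move=> jk; pose s1 := (t + (k + n - j)).-1; pose i0 : option (nat + nat) := Some (inr s1).
have s1S : s1.+1 = (t + k + n - j)%N by rewrite /s1; lia.
pose T := g_sigma_algebraType (other_events noises i0).
have mxh : measurable_mx (xhat t : T -> _).
  by have [|//] := @past_measurable s1 t; rewrite /s1; lia.
have mcol q p r (Y : T -> 'M[R]_(q, r)) (Z : T -> 'M[R]_(p, r)) :
    measurable_mx Y -> measurable_mx Z -> measurable_mx (fun om => col_mx (Y om) (Z om)).
  move=> mY mZ i c; case: (split_ordP i) => a ->.
    by under eq_fun do rewrite col_mxEu; exact: mY.
  by under eq_fun do rewrite col_mxEd; exact: mZ.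
have cM p q (D : 'M[R]_(p, q)) r (Y : T -> 'M[R]_(q, r)) : measurable_mx Y ->
    measurable_mx (fun om => D *m Y om).
  by move=> mY; apply: measurable_mxM => //; exact: measurable_mx_cst.
have mtrunc a c : (t + c + n - a <= s1)%N -> measurable_mx (trunc a c : T -> _).
  move=> ac; apply: measurable_mxD.
    by apply: mcol; [exact: (cM)|exact: measurable_mx_cst].
  apply: measurable_mx_sum => b; case: (leqP a b) => ab; last exact: measurable_mx_cst.
  by apply: (cM); apply: past_output_measurable; have := ltn_ord b; lia.
(* [M] lists what must be annihilated, truncated so as not to depend on [v s1.+1]; [p] is the part
   of [trunc j k] free of that noise. *)
pose M (om : T) := row_mx (\mxrow_(i < j) g i) (\matrix_(a < _, i < k) trunc j i om a 0).
pose p (om : T) := trunc j.+1 k om + g j *m (C *m x s1.+1 om).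
have mM : measurable_mx M.
  apply: measurable_mx_row; first exact: measurable_mx_cst.
  move=> a i; under eq_fun do rewrite mxE.
  by apply: mtrunc; have := ltn_ord i; lia.
have mp : measurable_mx p.
  apply: measurable_mxD; first by apply: mtrunc; lia.
  by apply: (cM _ _ (g j)); apply: (cM); exact: fresh_state_measurable.
have annP om (f : 'rV[R]_(n + \sum_(i < n) l)) : f *m M om = 0 <->
    annihilates (E + F *m K) L (xhat^~ om) (y^~ om) t j k f.
  pose Z := \matrix_(a < _, i < k) trunc j i om a 0.
  have colZ (i : 'I_k) : f *m trunc j i om = col i (f *m Z).
    rewrite colE -mulmxA -colE; congr (_ *m _).
    by apply/matrixP => a b; rewrite [RHS]mxE [RHS]mxE ord1.
  rewrite /M -/Z mul_mx_row mul_mxrow; split.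
    rewrite -row_mx0 => /eq_row_mx[e1 e2].
    have f0 i : (i < j)%N -> f *m g i = 0.
      move=> ij; have := congr1 (fun Z => submxrow Z (Ordinal ij)) e1.
      by rewrite mxrowK submxrow0.
    split => // i ik.
    by rewrite (truncE _ _ f0) (colZ (Ordinal ik)) e2 col0.
  case=> f0 fz; rewrite -row_mx0; congr row_mx.
    rewrite -[RHS]submxrowK; apply: eq_mxrow => i.
    by rewrite submxrow0 f0.
  apply/matrixP => a i; have := fz i (ltn_ord i).
  by rewrite (truncE _ _ f0) colZ => /matrixP/(_ a 0); rewrite mxE => ->; rewrite !mxE.
have pE om : trunc j k om = p om + g j *m v s1.+1 om.
  rewrite /p -addrA -mulmxDr; have [_ <-] := plant_eq om s1.+1.
  rewrite s1S /trunc -addrA; congr (_ + _).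
  rewrite (bigD1 (Ordinal jk))//= leqnn addrC; congr (_ + _).
  rewrite [RHS](bigD1 (Ordinal jk))//= ltnn add0r; apply: eq_bigr => b bj.
  have bj' : nat_of_ord b <> j by move=> e; move/eqP: bj; apply; apply: val_inj.
  by rewrite (_ : (j < b)%N = (j <= b)%N)//; lia.
have := @fresh_annihilator _ _ _ P (other_events noises i0) (coord_events noises i0)
  _ _ _ M p (v s1.+1) (g j).
have mN := init_noise_measurable.
move=> /(_ (@other_events_setI _ _ _ _ _ _ _) (other_events_setT _ _)
  (@other_events_measurable _ _ _ _ _ _ mN _)
  (@coord_events_measurable _ _ _ _ _ _ mN _)
  (@other_events_indep _ _ _ _ _ _ _ init_indep _) mM mp (@measurable_mx_self _ _ _ _ _ noises i0)
  (@pd_noise_no_mass _ _ _ P _ _ _ V_pd (v_normal _))).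
apply: ae_imply => om h [f /annP fM fj]; have [|h' [h'M h'0]] := h; first by exists f.
exists h'; first exact/annP.
by rewrite (truncE (j := j)) ?pE//; have [] := (annP _ _).1 h'M.
Qed.

Lemma ae_exciting : {ae P, forall om,
  exciting (E + F *m K) L (xhat^~ om) (y^~ om) t}.
Proof.
apply: ae_foralln => j; apply: ae_foralln => k.
have [jk|kj] := ltnP j (k + n); last exact: aeW.
by apply: ae_imply (ae_exciting_step jk) => om h _; exact: h.
Qed.

End Excitation.

(** * Static gains and data matrices *)

Section Gains.
Context {R : realType}.

Lemma row_full_ker0 p q (X : 'M[R]_(p, q)) :
  row_full X <-> (forall z : 'cV[R]_q, X *m z = 0 -> z = 0).
Proof.
split=> [/row_fullP[Y YX] z Xz|X0].
  by rewrite -[z]mul1mx -YX -mulmxA Xz mulmx0.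
rewrite /row_full -mxrank_tr -/(row_free _) -kermx_eq0; apply/rowV0P => z /sub_kermxP zX.
by apply: trmx_inj; rewrite trmx0; apply: X0; rewrite -[X]trmxK -trmx_mul zX trmx0.
Qed.

Lemma observableP n l (A : 'M[R]_n) (C : 'M[R]_(l, n)) :
  observable A C <->
  (forall z : 'cV[R]_n, (forall i, (i < n)%N -> C *m A ^+ i *m z = 0) -> z = 0).
Proof.
rewrite /observable -/(row_full _) row_full_ker0.
split=> h z hz; apply: h.
  rewrite mxcol_mul -[RHS]submxcolK; apply: eq_mxcol => i.
  by rewrite submxcol0 hz.
move=> i ni; have := congr1 (fun Z => submxcol Z (Ordinal ni)) hz.
by rewrite mxcol_mul mxcolK submxcol0.
Qed.

Lemma observable_row n m (A : 'M[R]_n) (K : 'M[R]_(m, n)) i :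
  observable A (row i K) -> observable A K.
Proof.
move=> /observableP h; apply/observableP => z hz; apply: h => j nj.
by rewrite -!row_mul hz// row0.
Qed.

(** As long as [K] annihilates the orbit of [z], the feedback term vanishes along it, and
    [E + F *m K] moves [z] as [E] does. *)
Lemma observable_feedback n m (E : 'M[R]_n) (F : 'M[R]_(n, m)) (K : 'M[R]_(m, n)) :
  observable E K -> observable (E + F *m K) K.
Proof.
move=> /observableP h; apply/observableP => z hz; apply: h.
have e i : (i <= n)%N -> (E + F *m K) ^+ i *m z = E ^+ i *m z.
  elim: i => // i IH ni; rewrite !exprS -!mulmxE -!mulmxA -IH ?(ltnW ni)//.
  by rewrite mulmxDl -!mulmxA (mulmxA K) hz// mulmx0 addr0.
by move=> i ni; rewrite -mulmxA -e ?(ltnW ni)// mulmxA hz.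
Qed.

Lemma M_mx_stack n m k (E : 'M[R]_n) (F : 'M[R]_(n, k)) (H : 'M[R]_(m, n))
    (z : nat -> 'cV[R]_k) s :
  M_mx E F H *m stack n z s =
  \mxcol_(i < n) (\sum_(j < i) H *m E ^+ (i - j - 1) *m F *m z (s + j)%N).
Proof.
rewrite /M_mx /stack mxblockEv mxcol_mul; apply: eq_mxcol => i.
rewrite mul_mxrow_mxcol.
rewrite (eq_bigr (fun j : 'I_n => if (j < i)%N then
  H *m E ^+ (i - j - 1) *m F *m z (s + j)%N else 0)); last first.
  by move=> j _; case: ifP => // _; rewrite mul0mx.
rewrite -(big_mkord xpredT (fun j => if (j < i)%N then
  H *m E ^+ (i - j - 1) *m F *m z (s + j)%N else 0)).
rewrite (big_cat_nat (leq0n i) (ltnW (ltn_ord i)))/= [X in _ + X]big_nat_cond.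
rewrite [X in _ + X]big1 ?addr0 => [|j /andP[/andP[ij _] _]]; last by rewrite ltnNge ij.
by rewrite big_mkord; apply: eq_bigr => j _; rewrite ltn_ord.
Qed.

Lemma Fu_mx_stack n m (E : 'M[R]_n) (F : 'M[R]_(n, m)) (z : nat -> 'cV[R]_m) s :
  Fu_mx E F *m stack n z s = \sum_(j < n) E ^+ (n - j - 1) *m F *m z (s + j)%N.
Proof.
by rewrite /Fu_mx /stack mul_mxrow_mxcol; apply: eq_bigr => j _; rewrite subnS subn1.
Qed.

Section Controller.
Variables (n m l : nat) (E : 'M[R]_n) (F : 'M[R]_(n, m)) (G : 'M[R]_(n, l)).
Variables (H : 'M[R]_(m, n)) (xh : nat -> 'cV[R]_n) (u : nat -> 'cV[R]_m)
  (y : nat -> 'cV[R]_l).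
Hypothesis ctrl : controller E F G H xh u y.

Lemma controller_expand s i : xh (s + i)%N = E ^+ i *m xh s +
  \sum_(j < i) E ^+ (i - j - 1) *m F *m u (s + j)%N +
  \sum_(j < i) E ^+ (i - j - 1) *m G *m y (s.+1 + j)%N.
Proof.
have step p (D : 'M[R]_(n, p)) (z : nat -> 'cV[R]_p) i' :
    \sum_(j < i'.+1) E ^+ (i'.+1 - j - 1) *m D *m z j =
    E *m (\sum_(j < i') E ^+ (i' - j - 1) *m D *m z j) + D *m z i'.
  rewrite big_ord_recr /= subSnn subnn expr0 mul1mx; congr (_ + _).
  rewrite mulmx_sumr; apply: eq_bigr => j _; rewrite !mulmxA; congr (_ *m _ *m _).
  by rewrite mulmxE -exprS; congr (_ ^+ _); have := ltn_ord j; lia.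
elim: i => [|i IH]; first by rewrite !big_ord0 addn0 expr0 mul1mx !addr0.
rewrite (step _ F (fun j => u (s + j)%N)) (step _ G (fun j => y (s.+1 + j)%N)).
rewrite addnS; have [-> _] := ctrl (s + i); rewrite IH !mulmxDr.
rewrite exprS -mulmxE -mulmxA addSn -!addrA; congr (_ + (_ + _)).
by rewrite addrCA.
Qed.

Lemma controller_stack s : stack n u s = obsv_mx E H *m xh s +
  M_mx E F H *m stack n u s + M_mx E G H *m stack n y s.+1.
Proof.
rewrite !M_mx_stack /obsv_mx mxcol_mul -!mxcolD; apply: eq_mxcol => i.
have [_ ->] := ctrl (s + i); rewrite controller_expand !mulmxDr !mulmx_sumr.
congr (_ + _ + _); first by rewrite mulmxA.
  by apply: eq_bigr => j _; rewrite !mulmxA.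
by apply: eq_bigr => j _; rewrite !mulmxA.
Qed.

(** Observability makes the pseudoinverse of [obsv_mx E H] a left inverse, which recovers [xh s]
    from the window; the controller is then run [n] steps forward. *)
Lemma K_LQG_static : observable E H -> static_gain_from 0 u y (K_LQG E F G H).
Proof.
move=> /eqP obs s _; have [_ ->] := ctrl (s + n).
rewrite /K_LQG /= -(mulmxA H); congr (H *m _).
have [pOO _ _ _] := mp_pinvP (obsv_mx E H); set Pi := mp_pinv _ in pOO *.
have PiO : Pi *m obsv_mx E H = 1%:M.
  have /row_fullP[D DO] : row_full (obsv_mx E H) by rewrite /row_full obs.
  by rewrite -[LHS]mul1mx -{1}DO -[in RHS]DO -[in RHS]pOO !mulmxA.
have xE : xh s = Pi *m (stack n u s - M_mx E F H *m stack n u s -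
    M_mx E G H *m stack n y s.+1).
  by rewrite {1}controller_stack addrAC !addrK mulmxA PiO mul1mx.
rewrite controller_expand {1}xE -!Fu_mx_stack mul_row_col.
set U := stack n u s; set Y := stack n y s.+1.
have -> : (Fu_mx E F + E ^+ n *m Pi *m (1%:M - M_mx E F H)) *m U =
    Fu_mx E F *m U + E ^+ n *m (Pi *m (U - M_mx E F H *m U)).
  by rewrite mulmxDl -!mulmxA mulmxBl mul1mx.
rewrite mulmxBl -!mulmxA !mulmxBr [in RHS](addrC (Fu_mx E F *m U)).
by rewrite [X in X + _ = _]addrAC -[LHS]addrA; congr (_ + _); exact: addrC.
Qed.

Lemma data_mx_annihilator p c t
    (f : 'M[R]_(p, \sum_(i < n) m + \sum_(i < n) l)) :
  f *m data_mx n c u y t = 0 <-> forall j, (j < c)%N ->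
    f *m col_mx (stack n u (t + j)) (stack n y (t + j).+1) = 0.
Proof.
have colD (j : 'I_c) : col j (data_mx n c u y t) =
    col_mx (stack n u (t + j)) (stack n y (t + j).+1).
  rewrite /data_mx col_col_mx; congr col_mx; apply/matrixP => a b.
    by rewrite [LHS]mxE [LHS]mxE ord1.
  by rewrite [LHS]mxE [LHS]mxE ord1.
split=> [e j jc|e].
  by rewrite -(colD (Ordinal jc)) colE mulmxA e mul0mx.
apply/matrixP => a j; have := e j (ltn_ord j).
rewrite -colD colE mulmxA -colE => /matrixP/(_ a 0).
by rewrite mxE => ->; rewrite !mxE.
Qed.

Lemma next_inputs_static (K : 'M[R]_(m, \sum_(i < n) m + \sum_(i < n) l)) t0 c t :
  static_gain_from t0 u y K -> (t0 <= t)%N ->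
  next_inputs n c u t = K *m data_mx n c u y t.
Proof.
move=> sK tt; apply/eqP; rewrite -subr_eq0; apply/eqP.
apply/matrixP => a j; have := sK (t + j)%N (leq_trans tt (leq_addr _ _)).
rewrite addnAC => e; rewrite !mxE e mxE; apply/eqP; rewrite subr_eq0; apply/eqP.
apply: eq_bigr => b _; congr (_ * _).
by case: (split_ordP b) => b' ->; rewrite ?col_mxEu ?col_mxEd [RHS]mxE.
Qed.

(* [U *m pinv D] reproduces the inputs because [D *m pinv D] fixes the columns of [D]. *)
Lemma learned_gain_static (K : 'M[R]_(m, \sum_(i < n) m + \sum_(i < n) l)) t0 c t :
  static_gain_from t0 u y K -> (t0 <= t)%N ->
  (forall f : 'rV[R]_(\sum_(i < n) m + \sum_(i < n) l), f *m data_mx n c u y t = 0 ->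
    forall k, f *m col_mx (stack n u (t + k)) (stack n y (t + k).+1) = 0) ->
  static_gain_from t u y (learned_gain n c u y t).
Proof.
move=> sK tt spn s ts; rewrite /learned_gain (next_inputs_static _ sK tt).
set D := data_mx n c u y t; have [DD _ _ _] := mp_pinvP D; set X := mp_pinv D in DD *.
rewrite sK ?(leq_trans tt)// -(subnKC ts); set h := col_mx _ _.
have Z0 : (1%:M - D *m X) *m D = 0 by rewrite mulmxBl mul1mx DD subrr.
have : (1%:M - D *m X) *m h = 0.
  apply/row_matrixP => i; rewrite row_mul row0; apply: spn.
  by rewrite -row_mul -/D Z0 row0.
by rewrite mulmxBl mul1mx => /eqP; rewrite subr_eq0 => /eqP e; rewrite {1}e !mulmxA.
Qed.
End Controller.

(** The last time used is [t + n + c - 1], for inputs and outputs alike, whence the bound on [T]. *)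
Lemma eq_learned_gain n m l c (u u' : nat -> 'cV[R]_m) (y y' : nat -> 'cV[R]_l) t T :
  (forall s, (t <= s <= t + T)%N -> u' s = u s /\ y' s = y s) ->
  (c + n <= T.+1)%N ->
  learned_gain n c u' y' t = learned_gain n c u y t.
Proof.
move=> e cT; rewrite /learned_gain.
have hu j : (j < c)%N -> stack n u' (t + j) = stack n u (t + j).
  move=> jc; apply: eq_mxcol => i.
  by have [|->//] := e (t + j + i)%N; have := ltn_ord i; lia.
have hy j : (j < c)%N -> stack n y' (t + j).+1 = stack n y (t + j).+1.
  move=> jc; apply: eq_mxcol => i.
  by have [|_ ->//] := e ((t + j).+1 + i)%N; have := ltn_ord i; lia.
have -> : data_mx n c u' y' t = data_mx n c u y t.
  by rewrite /data_mx; congr col_mx; apply/matrixP => a j;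
    rewrite [LHS]mxE [RHS]mxE ?hu ?hy.
congr (_ *m _); apply/matrixP => a j; rewrite [LHS]mxE [RHS]mxE.
by have [|->//] := e (t + n + j)%N; have := ltn_ord j; lia.
Qed.

Section ClosedLoop.
Variables (n m l : nat) (Phi : 'M[R]_n) (L : 'M[R]_(n, l)) (K : 'M[R]_(m, n)).

(* The data column at time [s] is this matrix times the pair of the controller
   state [xhat s] and the outputs at times [s+1, ..., s+n]. *)
Definition data_factor :
    'M[R]_(\sum_(i < n) m + \sum_(i < n) l, n + \sum_(i < n) l) :=
  block_mx (obsv_mx Phi K) (M_mx Phi L K) 0 1%:M.

Lemma data_factorE (xh : nat -> 'cV[R]_n) (u : nat -> 'cV[R]_m) (y : nat -> 'cV[R]_l) s :
  (forall s, xh s.+1 = Phi *m xh s + L *m y s.+1) -> (forall s, u s = K *m xh s) ->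
  col_mx (stack n u s) (stack n y s.+1) = data_factor *m data_vec xh y s.
Proof.
move=> xhE uE; rewrite /data_factor /data_vec mul_block_col mul0mx add0r mul1mx.
(* The closed loop is itself a controller, with [Phi] for [E] and no input term. *)
have ctl : controller Phi 0 L K xh u y.
  by move=> r; rewrite mul0mx addr0; split; [exact: xhE|exact: uE].
congr col_mx; rewrite (controller_stack ctl); congr (_ + _).
suff -> : M_mx Phi 0 K *m stack n u s = 0 by rewrite addr0.
rewrite M_mx_stack -[RHS]submxcolK; apply: eq_mxcol => i; rewrite submxcol0.
by apply: big1 => j _; rewrite mulmx0 mul0mx.
Qed.

Lemma data_factor_full : observable Phi K -> row_full data_factor.
Proof.
move=> obs; apply/row_full_ker0 => z.
rewrite -[z]vsubmxK /data_factor mul_block_col mul0mx add0r mul1mx -[X in _ = X -> _]col_mx0.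
move=> /eq_col_mx[e1 e2]; rewrite e2 in e1 *; rewrite mulmx0 addr0 in e1.
suff -> : usubmx z = 0 by rewrite col_mx0.
by move: obs; rewrite /observable -/(row_full _) => /row_full_ker0; apply.
Qed.

End ClosedLoop.
End Gains.

(** * Single-input systems *)

Section SingleInput.
Context {R : realType}.

(* Replaces the finite set of maximal proper invariant subspaces: a union bound over
   the witnesses turns "for each a, almost surely" into "almost surely, for all a". *)
Lemma finite_annihilated_witnesses n (Phi : 'M[R]_n.+1) (O : 'rV[R]_n.+1 -> Prop) :
  (forall a p, O a -> O (a *m horner_mx Phi p)) ->
  exists s : seq 'rV[R]_n.+1, (forall a, a \in s -> a != 0 /\ O a) /\
    forall p, (exists a, [/\ a != 0, O a & a *m horner_mx Phi p = 0]) ->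
      exists2 a, a \in s & a *m horner_mx Phi p = 0.
Proof.
move=> OPhi; pose h := horner_mx Phi.
have hM p q (a : 'rV_n.+1) : a *m h (p * q) = a *m h p *m h q.
  by rewrite /h rmorphM /= -mulmxE mulmxA.
have hMC p q (a : 'rV_n.+1) : a *m h (p * q) = a *m h q *m h p.
  by rewrite mulrC hM.
(* Induction on the size of a polynomial [chi] that kills the functionals considered, starting from
   the characteristic polynomial. *)
suff H k : forall chi : {poly R}, (size chi <= k)%N -> chi != 0 ->
    exists s : seq 'rV[R]_n.+1, (forall a, a \in s -> a != 0 /\ O a) /\
    forall p, (exists a, [/\ a != 0, O a, a *m h chi = 0 & a *m h p = 0]) ->
      exists2 a, a \in s & a *m h p = 0.
  have chi0 : char_poly Phi != 0 by rewrite monic_neq0// char_poly_monic.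
  have [s [sO sP]] := H _ _ (leqnn _) chi0.
  exists s; split => // p [a [a0 Oa ap]]; apply: sP; exists a; split => //.
  by rewrite /h (Cayley_Hamilton Phi) mulmx0.
elim: k => [|k IH] chi; first by rewrite size_poly_leq0 => ->.
move=> szchi chi0.
have [[a0 [a00 Oa0 a0chi]]|none] :=
  pselect (exists a, [/\ a != 0, O a & a *m h chi = 0]); last first.
  by exists [::]; split => // p [a [a0 Oa achi ap]]; case: none; exists a.
(* Either [a0] alone serves for every [p], or some [p1] kills a functional [a1] but not [a0]. *)
have [allp|/existsNP[p1 /not_implyP[[a1 [a10 Oa1 a1chi a1p]] a0p]]] :=
  pselect (forall p, (exists a, [/\ a != 0, O a, a *m h chi = 0 & a *m h p = 0]) ->
    a0 *m h p = 0).
  exists [:: a0]; split=> [a|p /allp a0p]; last by exists a0; rewrite ?inE.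
  by rewrite inE => /eqP ->.
(* [d] is a proper divisor: nonconstant because it kills [a1], and not associate to [chi] because
   [chi] kills [a0] while [p1] does not. *)
pose d := gcdp p1 chi; have dchi : d %| chi by exact: dvdp_gcdr.
pose e := chi %/ d; have chiE : chi = e * d by rewrite /e divpK.
have [e0 d0] : e != 0 /\ d != 0.
  by apply/andP; rewrite -negb_or -mulf_eq0 -chiE.
have a1d : a1 *m h d = 0.
  have [[w1 w2] /= w12] := Bezoutp p1 chi.
  have /eqpP[[c1 c2] /= /andP[c10 c20]] := w12.
  move=> /(congr1 (fun q => a1 *m h q)).
  rewrite /h !horner_mxZ rmorphD -!scalemxAr mulmxDr -/h !hMC a1p a1chi !mul0mx addr0 scaler0.
  by move=> /esym/eqP; rewrite scaler_eq0 (negPf c20) => /eqP.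
have szd : (1 < size d)%N.
  rewrite ltnNge; apply/negP => /size1_polyC dC.
  move: a1d d0; rewrite dC polyC_eq0 /h horner_mx_C mul_mx_scalar => /eqP.
  by rewrite scaler_eq0 (negPf a10) orbF => ->.
have szchiE : size chi = (size e + size d).-1 by rewrite chiE size_mul.
have szd' : (size d < size chi)%N.
  rewrite ltn_neqAle dvdp_leq// andbT; apply/negP => sz.
  have : d %= chi by rewrite -dvdp_size_eqp.
  move=> /eqp_dvdl de; apply: a0p.
  have : chi %| p1 by rewrite -de dvdp_gcdl.
  by case/dvdpP => q ->; rewrite hMC a0chi mul0mx.
have [sd [sdO sdP]] := IH d (leq_trans szd' szchi) d0.
have sze : (size e <= k)%N.
  move: szchi szd; rewrite szchiE; move: (size e) (size d) => a b; lia.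
have [se [seO seP]] := IH e sze e0.
(* If [d] does not kill [a], then [a *m h d] is killed by [e] and by every [p] that kills [a]. *)
exists (sd ++ se); split=> [a|p [a [an0 Oa achi ap]]].
  by rewrite mem_cat => /orP[/sdO|/seO].
have [ad|ad] := eqVneq (a *m h d) 0.
  by have [|b bs bp] := sdP p; [exists a|exists b; rewrite ?mem_cat ?bs].
have [|b bs bp] := seP p; last by exists b; rewrite ?mem_cat ?bs ?orbT.
exists (a *m h d); split => //; first exact: OPhi.
  by rewrite -hM mulrC -chiE.
by rewrite -hMC hM ap mul0mx.
Qed.

Lemma controllable_annihilator n m (A : 'M[R]_n) (B : 'M[R]_(n, m)) (a : 'rV[R]_n) :
  controllable A B -> (forall i, (i < n)%N -> a *m A ^+ i *m B = 0) -> a = 0.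
Proof.
move=> AB aB; apply: (row_free_inj (A := ctrb_mx A B)) => //.
rewrite mul0mx mul_mxrow -[RHS]submxrowK; apply: eq_mxrow => i.
by rewrite submxrow0 mulmxA aB.
Qed.

Variables (n l : nat) (A : 'M[R]_n.+1) (B : 'M[R]_(n.+1, 1)) (C : 'M[R]_(l, n.+1)).
Variables (L : 'M[R]_(n.+1, l)) (K : 'M[R]_(1, n.+1)).
Hypothesis ctrl_AB : controllable A B.

Let Phi := ctrl_E A C L + ctrl_F B C L *m K.

Definition unreachable (a : 'rV[R]_n.+1) : Prop := forall i, a *m Phi ^+ i *m L = 0.

Lemma unreachable_horner a p : unreachable a -> unreachable (a *m horner_mx Phi p).
Proof.
move=> Oa i; rewrite -(mulmxA a) mulmxE.
have -> : horner_mx Phi p * Phi ^+ i = horner_mx Phi (p * 'X^i).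
  by rewrite rmorphM rmorphXn /= horner_mx_X.
rewrite -[p * _]coefK poly_def raddf_sum mulmx_sumr mulmx_suml big1// => j _ /=.
by rewrite horner_mxZ rmorphXn /= horner_mx_X -scalemxAr -scalemxAl Oa scaler0.
Qed.

(* On functionals that vanish on the reachable space of (Phi, L), the output
   injection in [ctrl_E] and [ctrl_F] is invisible, so that Phi acts as A + B K. *)
Lemma unreachable_eq0 a : unreachable a -> (forall i, a *m Phi ^+ i *m B = 0) -> a = 0.
Proof.
move=> Oa aB; apply: (controllable_annihilator ctrl_AB) => i _.
suff -> : a *m A ^+ i = a *m Phi ^+ i by exact: aB.
elim: i => [|i IH]; first by rewrite !expr0.
rewrite !exprSr -!mulmxE !mulmxA IH /Phi /ctrl_E /ctrl_F -/Phi mulmxDr !mulmxA.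
by rewrite mulmxBr mulmx1 !mulmxA Oa mul0mx subr0 aB mul0mx addr0.
Qed.

(** By [unreachable_eq0] the vectors [Phi ^+ i *m B] separate the unreachable functionals, so [xi]
    acts on these as a combination of them, that is, as [horner_mx Phi p *m B] for the single column
    [B]. *)
Lemma unreachable_cyclic (xi : 'cV[R]_n.+1) : exists p : {poly R},
  forall a, unreachable a -> a *m xi = a *m horner_mx Phi p *m B.
Proof.
pose Ob := kermx (\mxrow_(i < n.+1) (Phi ^+ i *m L)).
have ObO : forall a, (a <= Ob)%MS <-> unreachable a.
  move=> a; split=> [/sub_kermxP e|Oa].
    apply: krylov_annihilator => i ni; rewrite -mulmxA.
    have := congr1 (fun Z => submxrow Z (Ordinal ni)) e.
    by rewrite mul_mxrow mxrowK submxrow0.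
  apply/sub_kermxP; rewrite mul_mxrow -[RHS]submxrowK; apply: eq_mxrow => i.
  by rewrite submxrow0 mulmxA Oa.
pose Kr := \matrix_(b < n.+1, i < n.+1) (Phi ^+ i *m B) b 0.
have KrE k (g : 'M[R]_(k, n.+1)) i : g *m (Phi ^+ nat_of_ord i *m B) = col i (g *m Kr).
  rewrite colE -mulmxA -colE; congr (_ *m _).
  by apply/matrixP => b c; rewrite [RHS]mxE [RHS]mxE ord1.
(* Column-space inclusion, tested by left annihilators: a row killing [Ob *m Kr] gives an
   unreachable functional that must vanish. *)
have /submxP[D De] : ((Ob *m xi)^T <= (Ob *m Kr)^T)%MS.
  rewrite submxE; apply/eqP/trmx_inj; rewrite trmx0 trmx_mul trmxK.
  set g := (cokermx _)^T.
  have gN : g *m (Ob *m Kr) = 0.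
    by apply: trmx_inj; rewrite trmx_mul trmxK trmx0 mulmx_coker.
  apply/row_matrixP => r; rewrite row0 row_mul mulmxA.
  suff -> : row r g *m Ob = 0 by rewrite mul0mx.
  apply: unreachable_eq0; first by apply/ObO; exact: submxMl.
  move=> i; apply: krylov_annihilator => {}i ni; rewrite -mulmxA (KrE _ _ (Ordinal ni)).
  by rewrite -mulmxA -row_mul gN row0 col0.
have {}De : Ob *m xi = Ob *m Kr *m D^T by rewrite -[LHS]trmxK De trmx_mul trmxK.
exists (\poly_(i < n.+1) D^T (inord i) 0) => a /ObO/submxP[b ->].
set c := D^T in De *; rewrite -[LHS]mulmxA De -(mulmxA Ob).
have -> : Kr *m c = \sum_(i < n.+1) c i 0 *: (Phi ^+ i *m B).
  apply/matrixP => r s; rewrite [LHS]mxE summxE; apply: eq_bigr => i _.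
  by rewrite [RHS]mxE [Kr r i]mxE (ord1 s) mulrC.
rewrite poly_def [horner_mx _ _]raddf_sum !mulmx_sumr mulmx_suml; apply: eq_bigr => i _.
by rewrite inord_val /= horner_mxZ rmorphXn /= horner_mx_X -!scalemxAr -scalemxAl !mulmxA.
Qed.

(** Through [unreachable_cyclic], an unreachable [a] kills the orbit of [xi] exactly when it kills
    [horner_mx Phi p]; the finitely many witnesses for polynomials thus serve for all [xi]. *)
Lemma excitation_witnesses_succ : exists s : seq 'rV[R]_n.+1, (forall a, a \in s -> a != 0) /\
  forall (xi : 'cV[R]_n.+1) a, unreachable a -> (forall i, a *m Phi ^+ i *m xi = 0) ->
    a != 0 -> exists2 b, b \in s & unreachable b /\ forall i, b *m Phi ^+ i *m xi = 0.
Proof.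
have [s [sO sP]] := finite_annihilated_witnesses (fun a p => @unreachable_horner a p).
exists s; split=> [b /sO[]//|xi a Oa axi a0].
have [p pE] := unreachable_cyclic xi.
have shift b i : unreachable b ->
    b *m Phi ^+ i *m xi = b *m horner_mx Phi p *m Phi ^+ i *m B.
  move=> Ob; have hX : Phi ^+ i = horner_mx Phi 'X^i by rewrite rmorphXn /= horner_mx_X.
  rewrite pE; last by rewrite hX; exact: unreachable_horner.
  by rewrite hX; congr (_ *m B); rewrite -!(mulmxA b) !mulmxE -!rmorphM mulrC.
have [|b bs bp] := sP p.
  exists a; split => //; apply: unreachable_eq0; first exact: unreachable_horner.
  by move=> i; rewrite -shift.
have [_ Ob] := sO b bs; exists b => //; split => // i.
by rewrite shift// bp !mul0mx.
Qed.

End SingleInput.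

Lemma excitation_witnesses {R : realType} n m l (A : 'M[R]_n) (B : 'M[R]_(n, m))
    (C : 'M[R]_(l, n)) (L : 'M[R]_(n, l)) (K : 'M[R]_(m, n)) :
  (0 < n)%N -> m = 1%N -> controllable A B ->
  let Phi := ctrl_E A C L + ctrl_F B C L *m K in
  exists s : seq 'rV[R]_n, (forall a, a \in s -> a != 0) /\
  forall (xi : 'cV[R]_n) (a : 'rV[R]_n), (forall i, a *m Phi ^+ i *m L = 0) ->
    (forall i, a *m Phi ^+ i *m xi = 0) -> a != 0 ->
    exists2 b, b \in s & (forall i, b *m Phi ^+ i *m L = 0) /\
                          (forall i, b *m Phi ^+ i *m xi = 0).
Proof.
move=> n0 m1 AB; subst m; case: n A B C L K n0 AB => // n A B C L K _ AB.
exact: excitation_witnesses_succ.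
Qed.

(** * Assembly of the claims on the learned gain *)

Theorem mainTheorem4
  (R : realType) (d : measure_display) (Omega : measurableType d)
  (P : probability Omega R)
  (n m l : nat) (n_gt0 : (0 < n)%N)
  (A : 'M[R]_n) (B : 'M[R]_(n, m)) (C : 'M[R]_(l, n))
  (W : 'M[R]_n) (V : 'M[R]_l) (Q : 'M[R]_n) (Ru : 'M[R]_m)
  (Wh Qh : 'M[R]_n) (K : 'M[R]_(m, n)) (L : 'M[R]_(n, l))
  (W_psd : psd W) (V_pd : pd V) (Q_psd : psd Q) (Ru_pd : pd Ru)
  (Wh_sqrt : is_psd_sqrt Wh W) (Qh_sqrt : is_psd_sqrt Qh Q)
  (ctrl_AB : controllable A B) (ctrl_AW : controllable A Wh)
  (obs_AC : observable A C) (obs_AQ : observable A Qh)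
  (K_LQR : is_LQR_gain A B Q Ru K) (L_f : is_Kalman_gain A C W V L)
  (obs_EK : forall i : 'I_m, observable (ctrl_E A C L) (row i K))
  (ctrl_EL : controllable (ctrl_E A C L) L)
  (w : nat -> Omega -> 'cV[R]_n) (v : nat -> Omega -> 'cV[R]_l)
  (x xhat : nat -> Omega -> 'cV[R]_n)
  (u : nat -> Omega -> 'cV[R]_m) (y : nat -> Omega -> 'cV[R]_l)
  (w_normal : forall s, centred_gaussian P W (w s))
  (v_normal : forall s, centred_gaussian P V (v s))
  (x0_meas : random_vector (x 0%N)) (xhat0_meas : random_vector (xhat 0%N))
  (noise_indep : mutual_indep P (noise w v))
  (init_indep : mutual_indep P (init_noise (x 0%N) (xhat 0%N) w v))
  (* closed loop: u and y are the optimal inputs and outputs *)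
  (plant_eq : forall om, plant A B C (w^~ om) (v^~ om) (x^~ om) (u^~ om) (y^~ om))
  (controller_eq : forall om,
     controller (ctrl_E A C L) (ctrl_F B C L) L K (xhat^~ om) (u^~ om) (y^~ om))
  (t : nat) :
  let KLQG := K_LQG (ctrl_E A C L) (ctrl_F B C L) L K in
  [/\ forall om, static_gain_from 0 (u^~ om) (y^~ om) KLQG,
      forall c, (n * (l + 1) <= c)%N ->
        {ae P, forall om, static_gain_from t (u^~ om) (y^~ om)
           (learned_gain n c (u^~ om) (y^~ om) t)},
      (* only the values from time t to t + T are used *)
      forall T, (n * (l + 2) - 1 <= T)%N ->
        {ae P, forall om, forall (u' : nat -> 'cV[R]_m) (y' : nat -> 'cV[R]_l),
           (forall s, (t <= s <= t + T)%N -> u' s = u s om /\ y' s = y s om) ->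
           static_gain_from t (u^~ om) (y^~ om)
             (learned_gain n (T - n + 1) u' y' t)},
      m = 1%N ->
        (* the controller state is not confined to a proper subspace *)
        (forall a : 'rV[R]_n, a != 0 ->
           {ae P, forall om, exists2 s, (t <= s)%N & a *m xhat s om != 0}) ->
        forall c, (n * (l + 1) <= c)%N ->
        {ae P, forall om,
           [/\ row_free (data_mx n c (u^~ om) (y^~ om) t),
               learned_gain n c (u^~ om) (y^~ om) t = KLQG
             & forall K', static_gain_from t (u^~ om) (y^~ om) K' -> K' = KLQG]}
    & (1 < m)%N ->
        (forall c, (n * (l + 1) <= c)%N ->
           forall om, ~~ row_free (data_mx n c (u^~ om) (y^~ om) t)) /\
        exists2 K', K' != KLQG &
          forall om, static_gain_from 0 (u^~ om) (y^~ om) K'].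
Proof.
move=> KLQG; pose E := ctrl_E A C L; pose F := ctrl_F B C L; pose Phi := E + F *m K.
have l0 : (0 < l)%N.
  rewrite lt0n; apply/eqP => l0; have /eqP rk := ctrl_EL.
  have := rank_leq_col (ctrb_mx E L); rewrite rk sum_nat_const card_ord.
  by rewrite [X in (_ <= _ * X)%N]l0; lia.
have xhE om s : xhat s.+1 om = Phi *m xhat s om + L *m y s.+1 om.
  exact: controller_closed_loop controller_eq om s.
have uE om s : u s om = K *m xhat s om by have [] := controller_eq om s.
pose h om s := col_mx (stack n (u^~ om) s) (stack n (y^~ om) s.+1).
pose Z om := data_vec (xhat^~ om) (y^~ om).
pose Tm := data_factor Phi L K.
have hE om s : h om s = Tm *m Z om s by apply: data_factorE; [exact: xhE|exact: uE].
have static om : static_gain_from 0 (u^~ om) (y^~ om) KLQG.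
  case: (ltnP 0 m) => [m0|]; last first.
    by rewrite leqn0 => /eqP m0 s _; apply/matrixP => i; have := ltn_ord i; rewrite {2}m0.
  by apply: K_LQG_static (controller_eq om) (observable_row (obs_EK (Ordinal m0))).
have exc := ae_exciting V_pd w_normal v_normal x0_meas xhat0_meas init_indep
  plant_eq controller_eq t.
have annT om c (f : 'rV[R]_(\sum_(i < n) m + \sum_(i < n) l)) : (n * (l + 1) <= c)%N ->
    f *m data_mx n c (u^~ om) (y^~ om) t = 0 ->
    annihilates Phi L (xhat^~ om) (y^~ om) t 0 (n * (l + 1)) (f *m Tm).
  move=> cn /data_mx_annihilator e; split => // i ic.
  by rewrite -mulmxA -(hE om) e// (leq_trans ic).
have learned om c : exciting Phi L (xhat^~ om) (y^~ om) t -> (n * (l + 1) <= c)%N ->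
    static_gain_from t (u^~ om) (y^~ om) (learned_gain n c (u^~ om) (y^~ om) t).
  move=> ex cn; apply: (learned_gain_static (static om)) => // f fD k.
  rewrite -/(h om (t + k)%N) hE mulmxA.
  exact: (exciting_span (xhE om) l0 ex (annT om c f cn fD)).
split => //.
- by move=> c cn; apply: ae_imply exc => om ex; exact: learned.
- move=> T Tn; apply: ae_imply exc => om ex u' y' e.
  rewrite (eq_learned_gain e); last by lia.
  by apply: learned => //; lia.
- move=> m1 conf c cn.
  have [s [s0 sP]] := excitation_witnesses C L K n_gt0 m1 ctrl_AB.
  (* Only finitely many functionals are concerned, so the exceptional null sets may be united. *)
  have cfs := ae_all_seq (fun a as_ => conf a (s0 a as_)).
  apply: ae_imply (ae_conj exc cfs) => om [ex cf].
  (* For [m = 1] the factor [Tm] is square, so full column rank is full row rank. *)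
  have Tfree : row_free Tm.
    move: (data_factor_full L (observable_feedback F (observable_row
      (obs_EK (cast_ord (esym m1) ord0))))).
    by rewrite /row_full /row_free => /eqP ->; rewrite !sum_nat_const !card_ord m1 muln1.
  set D := data_mx n c (u^~ om) (y^~ om) t.
  have Dfree : row_free D.
    rewrite -kermx_eq0; apply/rowV0P => f /sub_kermxP fD.
    have [r0 fL fx] := exciting_annihilator (xhE om) l0 ex (annT om c f cn fD).
    apply: (row_free_inj Tfree); rewrite /= mul0mx -[LHS]hsubmxK r0.
    suff -> : lsubmx (f *m Tm) = 0 by rewrite row_mx0.
    apply/eqP/negPn/negP => an0.
    (* A nonzero state part would yield a witness [b] that kills the state at every time from [t]
       on, against [cf]. *)
    have [b bs [bL bx]] := sP (xhat t om) _ fL fx an0.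
    have [r tr /eqP] := cf b bs; apply.
    rewrite -(subnKC tr) (@xh_expand _ _ _ _ _ (xhat^~ om) (y^~ om) (xhE om)).
    rewrite mulmxDr mulmxA bx add0r mulmx_sumr.
    by apply: big1 => i _; rewrite !mulmxA bL mul0mx.
  have DX : D *m mp_pinv D = 1%:M.
    have [DXD _ _ _] := mp_pinvP D.
    by apply: (row_free_inj Dfree); rewrite /= DXD mul1mx.
  split => //.
    by rewrite /learned_gain (next_inputs_static _ (static om) (leq0n t)) -mulmxA DX mulmx1.
  move=> K' sK'; suff KD : K' *m D = KLQG *m D by exact: (row_free_inj Dfree KD).
  by rewrite -(next_inputs_static c sK' (leqnn t)) (next_inputs_static c (static om) (leq0n t)).
- move=> m1.
  (* [Tm] has [n * m + n * l] rows but only [n + n * l] columns, hence a left annihilator common to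
     all outcomes. *)
  have [f fT f0] : exists2 f : 'rV[R]_(\sum_(i < n) m + \sum_(i < n) l), f *m Tm = 0 & f != 0.
    have : kermx Tm != 0.
      rewrite kermx_eq0 /row_free neq_ltn (leq_ltn_trans (rank_leq_col Tm))//.
      rewrite !sum_nat_const !card_ord ltn_add2r -[ltnLHS]muln1.
      by rewrite ltn_pmul2l.
    by case/rowV0Pn => f /sub_kermxP fT f0; exists f.
  have fh om s : f *m h om s = 0 by rewrite hE mulmxA fT mul0mx.
  split.
    move=> c cn om; apply: contra f0 => free; apply/eqP.
    apply: (row_free_inj free); rewrite /= mul0mx.
    by apply/data_mx_annihilator => j _; exact: fh.
  (* Adding [f] to every row of the gain leaves its values on the data unchanged. *)
  exists (KLQG + const_mx 1 *m f).
    rewrite -subr_eq0 addrAC subrr add0r; apply: contra f0 => /eqP e.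
    apply/eqP/rowP => j; have /matrixP/(_ (Ordinal (ltnW m1)) j) := e.
    by rewrite !mxE big_ord1 mxE mul1r.
  by move=> om s _; rewrite mulmxDl -mulmxA (fh om s) mulmx0 addr0; exact: static.
Qed.
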